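(* Let $(D,T)$ be an instance of Position Matching with $|D|=|T|=n$, where $D$ contains exactly $p$ distinct numbers. Then $(D,T)$ can be reduced in $O(n^{p+1}p)$ time to an equivalent instance of Exact Matching whose graph has $O(n^{p+1}p)$ vertices and $O(n^{p+1}p)$ edges.
   Context: Discretized sequence: for a non-decreasing sequence $D=\langle d_1,\ldots,d_n\rangle$ of positive integers, its discretized sequence $A=\langle a_1,\ldots,a_n\rangle$ is defined by $a_n=d_n$ and $a_i=\min\{a_{i+1}-1,\ d_i\}$ for $i<n$. Position Matching problem: given a multiset $D=\{d_1,\ldots,d_n\}$ and a simple set $T=\{t_1,\ldots,t_n\}$ of positive integers, with $A$ the discretized sequence of $D$ sorted non-decreasingly, decide whether there is $M\subseteq D\times A\times T$ such that every element of $D$, $A$, $T$ occurs in exactly one triplet of $M$ and each $(d,a,t)\in M$ satisfies $d\geq a$ and $d+a\geq t$. Exact Matching: given a graph $G=(V,E)$, a subset $E'\subseteq E$ of red edges and a positive integer $k$, decide whether $G$ has a perfect matching containing exactly $k$ red edges. ''Equivalent'' means the Position Matching instance is a yes-instance iff the Exact Matching instance is. *)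

(* Defs.v *)
From mathcomp Require Import all_boot all_order all_algebra.

Set Implicit Arguments.
Unset Strict Implicit.
Unset Printing Implicit Defensive.

Import Order.TTheory GRing.Theory Num.Theory.

(** * Position Matching *)

(* The elements of the discretized sequence are integers, not naturals: some of
   them can be zero or negative, as in <1, 1, 1> |-> <-1, 0, 1>. *)
Fixpoint discretize (s : seq nat) : seq int :=
  match s with
  | [::] => [::]
  | [:: d] => [:: Posz d]
  | d :: s' =>
      let a := discretize s' in Num.min (head 0 a - 1)%R (Posz d) :: a
  end.

Lemma size_discretize s : size (discretize s) = size s.
Proof. by elim: s => [|d [|d' s] IHs] //; rewrite -[RHS]/(size (d' :: s)).+1 -IHs. Qed.

Lemma size_discretized n (D : n.-tuple nat) :
  size (discretize (sort leq D)) == n.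
Proof. by rewrite size_discretize size_sort size_tuple. Qed.

Definition discretized n (D : n.-tuple nat) : n.-tuple int :=
  Tuple (size_discretized D).

(* A multiset is given by a listing of its elements in arbitrary order, a simple
   set by a listing without repetition. *)
Definition pm_instance n (D T : n.-tuple nat) : bool :=
  [&& all (ltn 0) D, all (ltn 0) T & uniq T].

(* D being a multiset, the triplets of M consist of positions in D, A and T
   rather than values: equal numbers of D are distinct elements. *)
Definition pm_yes n (D T : n.-tuple nat) : Prop :=
  let A := discretized D in
  exists M : {set 'I_n * 'I_n * 'I_n},
    [/\ forall i, #|[set x in M | x.1.1 == i]| = 1,
        forall j, #|[set x in M | x.1.2 == j]| = 1,
        forall l, #|[set x in M | x.2 == l]| = 1
      & forall x, x \in M ->
          let d := Posz (tnth D x.1.1) in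
          let a := tnth A x.1.2 in
          let t := Posz (tnth T x.2) in
          (a <= d)%R /\ (t <= d + a)%R].

(** * Exact Matching *)

Record em_instance := EMInstance {
  em_nv : nat;
  em_edges : {set {set 'I_em_nv}};
  em_red : {set {set 'I_em_nv}};
  em_k : nat;
  em_edges_card2 : forall e, e \in em_edges -> #|e| = 2;
  em_red_sub : em_red \subset em_edges;
  em_k_gt0 : 0 < em_k
}.

Definition perfect_matching N (E M : {set {set 'I_N}}) : Prop :=
  M \subset E /\ forall v, #|[set e in M | v \in e]| = 1.

Definition em_yes (I : em_instance) : Prop :=
  exists M, perfect_matching (em_edges I) M /\ #|M :&: em_red I| = em_k I.

(** * Random access machines *)

(* The RAM of Cook and Reckhow (Time bounded random access machines, 1973), with
   unit cost per instruction.  The registers X_0, X_1, ... hold integers; the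
   only arithmetic is addition and subtraction, as unit-cost multiplication of
   unbounded integers would make the time measure unrealistic. *)
Inductive instr :=
| ConstI of nat & int          (* X_i <- c *)
| AddI of nat & nat & nat      (* X_i <- X_j + X_k *)
| SubI of nat & nat & nat      (* X_i <- X_j - X_k *)
| LoadI of nat & nat           (* X_i <- X_{X_j} *)
| StoreI of nat & nat          (* X_{X_i} <- X_j *)
| JumpPosI of nat & nat        (* go to instruction m if X_j > 0 *)
| ReadI of nat                 (* X_i <- next input number *)
| PrintI of nat.               (* output X_i *)

Definition program := seq instr.

Record config := Config {
  pc : nat;
  regs : nat -> int;
  inp : seq int;
  outp : seq int
}.

Definition upd (r : nat -> int) (i : nat) (z : int) : nat -> int :=
  fun j => if j == i then z else r j.

(* None on a failure: negative address or exhausted input. *)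
Definition exec (c : config) (op : instr) : option config :=
  let: Config q r x y := c in
  match op with
  | ConstI i z => Some (Config q.+1 (upd r i z) x y)
  | AddI i j k => Some (Config q.+1 (upd r i (r j + r k)%R) x y)
  | SubI i j k => Some (Config q.+1 (upd r i (r j - r k)%R) x y)
  | LoadI i j =>
      if r j is Posz a then Some (Config q.+1 (upd r i (r a)) x y) else None
  | StoreI i j =>
      if r i is Posz a then Some (Config q.+1 (upd r a (r j)) x y) else None
  | JumpPosI j m => Some (Config (if (0 < r j)%R then m else q.+1) r x y)
  | ReadI i =>
      if x is z :: x' then Some (Config q.+1 (upd r i z) x' y) else None
  | PrintI i => Some (Config q.+1 r x (rcons y (r i)))
  end.

(* The machine halts when the program counter leaves the program. *)
Fixpoint run (P : program) (t : nat) (c : config) : option (seq int) :=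
  if size P <= pc c then Some (outp c)
  else if t is t'.+1 then
    obind (run P t') (exec c (nth (ConstI 0 0) P (pc c)))
  else None.

Definition computes_within (P : program) (x y : seq int) (t : nat) : Prop :=
  run P t (Config 0 (fun=> 0%R) x [::]) = Some y.

(** * Encodings of instances *)

Definition pm_encoding n (D T : n.-tuple nat) : seq int :=
  Posz n :: map Posz D ++ map Posz T.

Definition edge_ends N (e : 'I_N * 'I_N * bool) : {set 'I_N} :=
  [set e.1.1; e.1.2].

Definition edge_code N (e : 'I_N * 'I_N * bool) : seq int :=
  [:: Posz e.1.1; Posz e.1.2; Posz (nat_of_bool e.2)].

(* The number of vertices, the number k, and then, for each edge, listed once,
   its two end vertices and a bit telling whether it is red. *)
Definition em_encoded (I : em_instance) (y : seq int) : Prop :=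
  exists es : seq ('I_(em_nv I) * 'I_(em_nv I) * bool),
    [/\ uniq (map (@edge_ends _) es),
        em_edges I = [set:: map (@edge_ends _) es],
        em_red I = [set:: map (@edge_ends _) (filter snd es)]
      & y = Posz (em_nv I) :: Posz (em_k I) ::
              flatten (map (@edge_code _) es)].

(* Main.v *)
Require Import Defs.
From mathcomp Require Import all_boot all_order all_algebra.
From mathcomp Require Import zify.

(** Call the [p] distinct values of [D] colours.  A solution of Position Matching
   is a perfect matching between the [a]'s and the [t]'s whose edges carry colours,
   an edge [(a, t)] of colour [d] being allowed iff [a <= d] and [t <= d + a], such
   that the colour [d] is used as often as [d] occurs in [D].  Give the [c]-th
   colour the weight [n ^ c].  For [p > 1] the multiplicities lie strictly between
   [0] and [n], so they are the digits in base [n] of the total weight [k] of [D],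
   and a perfect matching of weight [k] uses every colour as often as required (at
   most [n] times each, so no other digits are possible).
   An edge of weight [w] becomes a path with [2 w] inner vertices and [w] red edges:
   its inner vertices are matched among themselves, without red edges, or else with
   the help of both ends, using all red edges.  If the edge is not allowed, the path
   lacks its last edge, which leaves only the first possibility.  There are [n ^ 2]
   paths for each colour, and their total length is [O(n ^ p.+1 * p)]. *)

Set Implicit Arguments.
Unset Strict Implicit.
Unset Printing Implicit Defensive.

Import Order.TTheory GRing.Theory Num.Theory.

(** * Structured programs *)

(** The machine must print the number of vertices before any edge. A path is therefore laid out for
    every virtual edge, allowed or not, so that this number, [2 n + 2 S n ^ 2] with [S] the sum of
    the colour weights, follows from the colours of [D] alone. Virtual edges of different colours
    join the same two vertices, so the intermediate object is a weighted multigraph; since all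
    weights are positive, subdividing it yields a simple graph. [D] is sorted in non-increasing
    order: the discretized sequence, the colours and their weights are then recurrences running
    forward from the head of the list. As [p >= 1], the bound is at least [n ^ 2], which pays for
    insertion sort and for multiplying by [n] through repeated addition, the machine having no
    multiplication. Jump addresses being absolute, correctness and cost are established for a small
    structured language whose compilation preserves the number of steps exactly. *)

Inductive stmt :=
| Op of instr
| Seq of stmt & stmt
| If of nat & stmt & stmt
| While of nat & stmt.

Fixpoint code_size (s : stmt) : nat :=
  match s with
  | Op _ => 1
  | Seq s1 s2 => code_size s1 + code_size s2
  | If _ s1 s2 => code_size s2 + code_size s1 + 3
  | While _ s => code_size s + 5
  end.

(* [o] is the address of the first instruction.  An unconditional jump is a
   jump on register 0, which is set to 1 beforehand. *)
Fixpoint compile (o : nat) (s : stmt) : program :=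
  match s with
  | Op i => [:: i]
  | Seq s1 s2 => compile o s1 ++ compile (o + code_size s1) s2
  | If x s1 s2 =>
      let o1 := o + code_size s2 + 3 in
      JumpPosI x o1 :: compile o.+1 s2 ++
      [:: ConstI 0 1; JumpPosI 0 (o1 + code_size s1)] ++ compile o1 s1
  | While x s =>
      [:: JumpPosI x (o + 3); ConstI 0 1; JumpPosI 0 (o + code_size s + 5)] ++
      compile (o + 3) s ++ [:: ConstI 0 1; JumpPosI 0 o]
  end.

Lemma size_compile o s : size (compile o s) = code_size s.
Proof.
elim: s o => //= [s1 IH1 s2 IH2|x s1 IH1 s2 IH2|x s IH] o;
  rewrite ?size_cat /= ?size_cat ?IH1 ?IH2 ?IH /=; lia.
Qed.

Definition state := ((nat -> int) * seq int * seq int)%type.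

Definition at_pc (q : nat) (st : state) : config := Config q st.1.1 st.1.2 st.2.

Definition no_jump (i : instr) := if i is JumpPosI _ _ then false else true.

(** The trace left by a compiled unconditional jump: register 0 keeps no value across it. *)
Definition raise_flag (st : state) : state := (upd st.1.1 0 1%R, st.1.2, st.2).

(** The counts are those of the compiled code: one step for the conditional jump, two more wherever
    register 0 is set and jumped on. *)
Inductive eval : stmt -> state -> state -> nat -> Prop :=
| EvalOp i st st' : no_jump i ->
    exec (at_pc 0 st) i = Some (at_pc 1 st') -> eval (Op i) st st' 1
| EvalSeq s1 s2 st st1 st2 t1 t2 :
    eval s1 st st1 t1 -> eval s2 st1 st2 t2 -> eval (Seq s1 s2) st st2 (t1 + t2)
| EvalIfT x s1 s2 st st' t : (0 < st.1.1 x)%R ->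
    eval s1 st st' t -> eval (If x s1 s2) st st' t.+1
| EvalIfF x s1 s2 st st' t : (0 < st.1.1 x)%R = false ->
    eval s2 st st' t -> eval (If x s1 s2) st (raise_flag st') t.+3
| EvalWhileT x s st st1 st2 t1 t2 : (0 < st.1.1 x)%R ->
    eval s st st1 t1 -> eval (While x s) (raise_flag st1) st2 t2 ->
    eval (While x s) st st2 (t1 + t2).+3
| EvalWhileF x s st : (0 < st.1.1 x)%R = false ->
    eval (While x s) st (raise_flag st) 3.

Lemma run_step (P : program) t c c' : pc c < size P ->
  exec c (nth (ConstI 0 0) P (pc c)) = Some c' -> run P t.+1 c = run P t c'.
Proof. by move=> h e; rewrite /= leqNgt h /= e. Qed.

Lemma exec_at_pc q i st st' : no_jump i ->
  exec (at_pc 0 st) i = Some (at_pc 1 st') ->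
  exec (at_pc q st) i = Some (at_pc q.+1 st').
Proof.
case: st st' => [[r x] y] [[r' x'] y'].
by case: i => //= [i z|i j k|i j k|i j|i j|i|i] _; rewrite /at_pc /=;
   try (case: (r _) => // ?); try (case: x => // ? ?); case=> -> -> ->.
Qed.

Lemma run_at (P pre c post : program) i t q st c' : P = pre ++ c ++ post ->
  i < size c -> q = size pre + i ->
  exec (at_pc q st) (nth (ConstI 0 0) c i) = Some c' ->
  run P t.+1 (at_pc q st) = run P t c'.
Proof.
move=> -> lti -> e; apply: run_step; first by rewrite /= !size_cat; lia.
by rewrite /= nth_cat ltnNge leq_addr /= addKn nth_cat lti.
Qed.

Lemma run_jump (P pre c post : program) i t q st x m : P = pre ++ c ++ post ->
  i < size c -> q = size pre + i -> nth (ConstI 0 0) c i = JumpPosI x m ->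
  run P t.+1 (at_pc q st) =
  run P t (at_pc (if (0 < st.1.1 x)%R then m else q.+1) st).
Proof. by move=> eP lti eq ei; apply: (run_at t eP lti eq); rewrite ei. Qed.

Lemma run_goto (P pre c post : program) i t q st m : P = pre ++ c ++ post ->
  i.+1 < size c -> q = size pre + i ->
  nth (ConstI 0 0) c i = ConstI 0 1 ->
  nth (ConstI 0 0) c i.+1 = JumpPosI 0 m ->
  run P t.+2 (at_pc q st) = run P t (at_pc m (raise_flag st)).
Proof.
move=> eP lti eq e1 e2.
rewrite (run_at (c' := at_pc q.+1 (raise_flag st)) t.+1 eP (ltnW lti) eq).
  by rewrite (run_jump t (raise_flag st) eP lti _ e2) // eq addnS.
by rewrite e1.
Qed.

(** The compiled code sits between arbitrary [pre] and [post], and [t'] steps remain; the induction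
    needs this freedom for sequences and for the jump back to the head of a loop. *)
Lemma run_eval s st st' t : eval s st st' t ->
  forall (P pre post : program) o t',
  P = pre ++ compile o s ++ post -> o = size pre ->
  run P (t + t') (at_pc o st) = run P t' (at_pc (o + code_size s) st').
Proof.
elim=> {s st st' t} [i st st' nj e|s1 s2 st st1 st2 t1 t2 _ IH1 _ IH2
  |x s1 s2 st st' t xp _ IH|x s1 s2 st st' t xp _ IH
  |x s st st1 st2 t1 t2 xp _ IH1 _ IH2|x s st xp] P pre post o t' eP eo.
- rewrite (run_at (c' := at_pc (o + 1) st') t' eP (i := 0)) //; first by rewrite eo addn0.
  by rewrite /= addn1; apply: exec_at_pc.
- rewrite -addnA (IH1 P pre (compile (o + code_size s1) s2 ++ post)) //; last by rewrite eP /= -!catA.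
  rewrite (IH2 P (pre ++ compile o s1) post) //= ?size_cat ?size_compile ?eo ?addnA //.
  by rewrite eP eo /= !catA.
- set o1 := o + code_size s2 + 3 in eP *.
  rewrite addSn (run_jump (i := 0) (x := x) (m := o1) _ st eP) ?addn0 // xp.
  rewrite (IH P (pre ++ (JumpPosI x o1 :: compile o.+1 s2 ++
           [:: ConstI 0 1; JumpPosI 0 (o1 + code_size s1)])) post).
  + by congr (run _ _ (at_pc _ _)); rewrite /o1 /=; lia.
  + by rewrite eP /= -!catA /= -!catA.
  by rewrite !size_cat /= size_cat size_compile /= /o1 eo; lia.
- set o1 := o + code_size s2 + 3 in eP *.
  rewrite !addSn (run_jump (i := 0) (x := x) (m := o1) _ st eP) ?addn0 // xp.
  rewrite -!addnS (IH P (pre ++ [:: JumpPosI x o1]) ([:: ConstI 0 1; JumpPosI 0 (o1 + code_size s1)] ++ compile o1 s1 ++ post)).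
  + have e1 : nth (ConstI 0 0) (compile o (If x s1 s2)) (code_size s2).+1 = ConstI 0 1.
      by rewrite /= nth_cat size_compile ltnn subnn.
    have e2 : nth (ConstI 0 0) (compile o (If x s1 s2)) (code_size s2).+2 = JumpPosI 0 (o1 + code_size s1).
      by rewrite /= nth_cat size_compile ltnNge leqnSn /= subSnn.
    rewrite (run_goto _ _ eP _ _ e1 e2).
    * by congr (run _ _ (at_pc _ _)); rewrite /o1 /=; lia.
    * by rewrite size_compile /=; lia.
    by rewrite eo; lia.
  + by rewrite eP /= -!catA.
  by rewrite size_cat eo addn1.
- rewrite !addSn (run_jump (i := 0) (x := x) (m := o + 3) _ st eP) ?addn0 // xp.
  rewrite -addnA -!addnS (IH1 P (pre ++ [:: JumpPosI x (o + 3); ConstI 0 1; JumpPosI 0 (o + code_size s + 5)])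
    ([:: ConstI 0 1; JumpPosI 0 o] ++ post)).
  + have e1 : nth (ConstI 0 0) (compile o (While x s)) (code_size s).+3 = ConstI 0 1.
      by rewrite /= nth_cat size_compile ltnn subnn.
    have e2 : nth (ConstI 0 0) (compile o (While x s)) (code_size s).+4 = JumpPosI 0 o.
      by rewrite /= nth_cat size_compile ltnNge leqnSn /= subSnn.
    rewrite !addnS (run_goto _ _ eP _ _ e1 e2).
    * by rewrite (IH2 P pre post) //= addnS.
    * by rewrite size_compile /=; lia.
    by rewrite eo; lia.
  + by rewrite eP /= -!catA.
  by rewrite size_cat eo.
- rewrite !addSn (run_jump (i := 0) (x := x) (m := o + 3) _ st eP) ?addn0 // xp.
  rewrite (run_goto (i := 1) (m := o + code_size s + 5) _ st eP) //.
  + by rewrite add0n addnA.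
  by rewrite eo addn1.
Qed.

(** * Total correctness with a time bound *)

Definition wp (s : stmt) (b : nat) (Q : state -> Prop) (st : state) : Prop :=
  exists st' t, [/\ eval s st st' t, t <= b & Q st'].

Lemma run_mono (P : program) t t' c y : t <= t' -> run P t c = Some y -> run P t' c = Some y.
Proof.
elim: t t' c => [|t IH] [|t'] c //=.
  by case: ifP.
move=> le; case: ifP => // _; case: exec => //= c'; exact: IH.
Qed.

Lemma computes_within_wp s b x y :
  wp s b (fun st => st.2 = y) (fun=> 0%R, x, [::]) ->
  computes_within (compile 0 s) x y b.
Proof.
case=> st' [t [ev le <-]]; apply: (run_mono le).
have /= := run_eval ev (P := compile 0 s) (pre := [::]) (post := [::]) (o := 0) 0.
rewrite cats0 addn0 /computes_within /at_pc /= => -> //.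
by rewrite size_compile add0n leqnn.
Qed.

Lemma wp_weaken s b b' (Q Q' : state -> Prop) st : wp s b Q st -> b <= b' ->
  (forall st', Q st' -> Q' st') -> wp s b' Q' st.
Proof.
case=> st' [t [ev le q]] lb QQ'; exists st', t; split=> //; last exact: QQ'.
exact: leq_trans lb.
Qed.

Lemma wp_op i b Q st st' : no_jump i -> 0 < b ->
  exec (at_pc 0 st) i = Some (at_pc 1 st') -> Q st' -> wp (Op i) b Q st.
Proof. by move=> nj b0 e q; exists st', 1; split=> //; apply: EvalOp. Qed.

Lemma wp_seq s1 s2 b1 b2 Q st :
  wp s1 b1 (wp s2 b2 Q) st -> wp (Seq s1 s2) (b1 + b2) Q st.
Proof.
case=> st1 [t1 [ev1 le1 [st2 [t2 [ev2 le2 q]]]]].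
by exists st2, (t1 + t2); split; [apply: EvalSeq ev1 ev2|apply: leq_add|].
Qed.

Lemma wp_if x s1 s2 b Q st :
  (if (0 < st.1.1 x)%R then wp s1 b Q st
   else wp s2 b (fun st' => Q (raise_flag st')) st) ->
  wp (If x s1 s2) (b + 3) Q st.
Proof.
case: ifP => xp [st' [t [ev le q]]].
  by exists st', t.+1; split=> //; [apply: EvalIfT | lia].
by exists (raise_flag st'), t.+3; split=> //; [apply: EvalIfF | lia].
Qed.

Lemma wp_while_stop x s b Q st : (st.1.1 x <= 0)%R -> 3 <= b -> Q (raise_flag st) ->
  wp (While x s) b Q st.
Proof.
move=> xp le q; exists (raise_flag st), 3; split=> //; apply: EvalWhileF.
by rewrite ltNge xp.
Qed.

Lemma wp_while_step x s b1 b2 Q st : (0 < st.1.1 x)%R ->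
  wp s b1 (fun st1 => wp (While x s) b2 Q (raise_flag st1)) st ->
  wp (While x s) (b1 + b2 + 3) Q st.
Proof.
move=> xp [st1 [t1 [ev1 le1 [st2 [t2 [ev2 le2 q]]]]]].
exists st2, (t1 + t2).+3; split=> //; first exact: EvalWhileT ev2.
lia.
Qed.

(** * The program *)

Notation "s1 ;; s2" := (Seq s1 s2) (at level 60, right associativity).

Definition cst i z := Op (ConstI i z).
Definition copy i j := cst 0 0 ;; Op (AddI i j 0).
Definition inc i := cst 0 1 ;; Op (AddI i i 0).
Definition print_reg i := Op (PrintI i).
Definition printc z := cst 0 z ;; print_reg 0.
Definition nop := cst 0 0.
(** The counter [x] is decremented before the body, which thus sees the number of rounds still to
    come. *)
Definition for_ x s := While x (cst 0 1 ;; Op (SubI x x 0) ;; s).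

Section Rules.
Implicit Types (Q : state -> Prop) (r : nat -> int) (x y : seq int).

Lemma wp_cst Q r x y i z : Q (upd r i z, x, y) -> wp (cst i z) 1 Q (r, x, y).
Proof. exact: wp_op. Qed.

Lemma wp_add Q r x y i j k : Q (upd r i (r j + r k)%R, x, y) ->
  wp (Op (AddI i j k)) 1 Q (r, x, y).
Proof. exact: wp_op. Qed.

Lemma wp_sub Q r x y i j k : Q (upd r i (r j - r k)%R, x, y) ->
  wp (Op (SubI i j k)) 1 Q (r, x, y).
Proof. exact: wp_op. Qed.

Lemma wp_load Q r x y i j a z : r j = Posz a -> r a = z -> Q (upd r i z, x, y) ->
  wp (Op (LoadI i j)) 1 Q (r, x, y).
Proof. by move=> e <-; apply: wp_op => //=; rewrite e. Qed.

Lemma wp_store Q r x y i j a : r i = Posz a -> Q (upd r a (r j), x, y) ->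
  wp (Op (StoreI i j)) 1 Q (r, x, y).
Proof. by move=> e; apply: wp_op => //=; rewrite e. Qed.

Lemma wp_read Q r x y i z : Q (upd r i z, x, y) -> wp (Op (ReadI i)) 1 Q (r, z :: x, y).
Proof. exact: wp_op. Qed.

Lemma wp_print Q r x y i : Q (r, x, rcons y (r i)) -> wp (print_reg i) 1 Q (r, x, y).
Proof. exact: wp_op. Qed.

Lemma wp_printc Q r x y z : Q (upd r 0 z, x, rcons y z) -> wp (printc z) 2 Q (r, x, y).
Proof. by move=> q; apply: (wp_seq (b1 := 1) (b2 := 1)); apply: wp_cst; apply: wp_print. Qed.

Lemma wp_copy Q r x y i j : j != 0 -> Q (upd (upd r 0 0%R) i (r j), x, y) ->
  wp (copy i j) 2 Q (r, x, y).
Proof.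
move=> j0 q; apply: (wp_seq (b1 := 1) (b2 := 1)); apply: wp_cst; apply: wp_add.
by rewrite {3 4}/upd (negPf j0) eqxx addr0.
Qed.

Lemma wp_inc Q r x y i : i != 0 -> Q (upd (upd r 0 1%R) i (r i + 1)%R, x, y) ->
  wp (inc i) 2 Q (r, x, y).
Proof.
move=> i0 q; apply: (wp_seq (b1 := 1) (b2 := 1)); apply: wp_cst; apply: wp_add.
by rewrite {3 4}/upd (negPf i0) eqxx.
Qed.

Lemma wp_for0 Q r x y i s : r i = 0%R -> Q (upd r 0 1%R, x, y) ->
  wp (for_ i s) 3 Q (r, x, y).
Proof. by move=> e; apply: wp_while_stop => //=; rewrite e. Qed.

Lemma wp_forS Q r x y i s m b1 b2 : i != 0 -> r i = Posz m.+1 ->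
  wp s b1 (fun st => wp (for_ i s) b2 Q (raise_flag st))
     (upd (upd r 0 1%R) i (Posz m), x, y) ->
  wp (for_ i s) (b1 + b2 + 5) Q (r, x, y).
Proof.
move=> i0 e q; rewrite -[5]/(2 + 3) addnA (addnC _ 2) addnA.
apply: wp_while_step; first by rewrite /= e.
apply: (wp_seq (b1 := 1) (b2 := 1 + b1)); apply: wp_cst.
apply: (wp_seq (b1 := 1) (b2 := b1)); apply: wp_sub.
rewrite {3 4}/upd (negPf i0) eqxx e.
by have -> : (Posz m.+1 - 1)%R = Posz m by lia.
Qed.


End Rules.

(** * Frame conditions: [X] lists the registers that a piece of code may overwrite *)

Definition same (X : seq nat) (r r' : nat -> int) :=
  forall i, i \notin X -> r' i = r i.

Lemma same_refl X r : same X r r. Proof. by []. Qed.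

Lemma same_upd X r r' i z : i \in X -> same X r r' -> same X r (upd r' i z).
Proof. by move=> iX h k kX; rewrite /upd; case: eqP kX => [->|_ /h //]; rewrite iX. Qed.

Lemma same_trans X Y r r1 r2 : same Y r1 r2 -> all (mem X) Y -> same X r r1 ->
  same X r r2.
Proof. by move=> h2 /allP YX h1 k kX; rewrite h2 ?h1 //; apply: contra kX; apply: YX. Qed.

Lemma same_subset X Y r r1 : same Y r r1 -> all (mem X) Y -> same X r r1.
Proof. by move=> h YX; apply: (same_trans h). Qed.

Lemma wp_weak s b (Q Q' : state -> Prop) st : wp s b Q st ->
  (forall st', Q st' -> Q' st') -> wp s b Q' st.
Proof. by move=> h; apply: wp_weaken h _. Qed.

Lemma wp_bound s b b' (Q : state -> Prop) st : wp s b Q st -> b <= b' -> wp s b' Q st.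
Proof. by move=> h le; apply: wp_weaken h _ _. Qed.

(** * Edge lists and the paths that replace virtual edges *)

(* The two ends and the weight, which is 1 for a red edge and 0 for another. *)
Definition edge := (nat * nat * nat)%type.
(* The virtual edge [(a, u, w, f)], of weight [w], is present iff [f]; it is
   subdivided even when it is absent. *)
Definition vedge := (nat * nat * nat * bool)%type.

Fixpoint path_edges w u v : seq edge :=
  if w is w'.+1 then (u, v, 1) :: (v, v.+1, 0) :: path_edges w' v.+1 v.+2 else [::].

Fixpoint path_end w u v : nat :=
  if w is w'.+1 then path_end w' v.+1 v.+2 else u.

Definition subdivide (e : vedge) v : seq edge :=
  let: (a, u, w, f) := e in
  path_edges w u v ++ (if f then [:: (a, path_end w u v, 0)] else [::]).

Definition vweight (e : vedge) := e.1.2.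

Fixpoint subdivide_all v (L : seq vedge) : seq edge :=
  if L is e :: L' then subdivide e v ++ subdivide_all (v + (vweight e).*2) L'
  else [::].

Definition vsize v (L : seq vedge) := v + (sumn (map vweight L)).*2.

Lemma subdivide_all_cat v L1 L2 :
  subdivide_all v (L1 ++ L2) = subdivide_all v L1 ++ subdivide_all (vsize v L1) L2.
Proof.
elim: L1 v => [|e L1 IH] v; first by rewrite /vsize /= addn0.
by rewrite /= IH catA /vsize /= doubleD addnA.
Qed.

Lemma vsize_cat v L1 L2 : vsize v (L1 ++ L2) = vsize (vsize v L1) L2.
Proof. by rewrite /vsize map_cat sumn_cat doubleD addnA. Qed.

Definition code (E : seq edge) : seq int :=
  flatten [seq [:: Posz e.1.1; Posz e.1.2; Posz e.2] | e <- E].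

Lemma code_cat E1 E2 : code (E1 ++ E2) = code E1 ++ code E2.
Proof. by rewrite /code map_cat flatten_cat. Qed.

Definition feas (y : nat) (a : int) (t : nat) : bool :=
  (a <= Posz y)%R && (Posz t <= Posz y + a)%R.

Definition row_vedges (y w : nat) (a : int) (j l : nat) (ts : seq nat) : seq vedge :=
  [seq (j, p.1, w, feas y a p.2) | p <- zip (iota l (size ts)) ts].

(* The discretized sequence of a non-increasing [ds], also in decreasing order. *)
Fixpoint disc (a : int) (ds : seq nat) : seq int :=
  if ds is d :: ds' then let a' := Num.min (a - 1)%R (Posz d) in a' :: disc a' ds'
  else [::].

Definition colour_vedges y w j n ts (As : seq int) : seq vedge :=
  flatten [seq row_vedges y w p.2 p.1 n ts | p <- zip (iota j (size As)) As].

(* Each new element [y < prev] of a non-increasing sequence, with its weight. *)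
Fixpoint colours (n prev w : nat) (ds : seq nat) : seq (nat * nat) :=
  if ds is y :: ds' then
    if y < prev then (y, w) :: colours n y (w * n) ds' else colours n prev w ds'
  else [::].

Definition arr (r : nat -> int) (p : nat) (s : seq nat) :=
  forall i, i < size s -> r (p + i) = Posz (nth 0 s i).

Lemma arr_head r p x s : arr r p (x :: s) -> r p = Posz x.
Proof. by move=> /(_ 0 isT); rewrite addn0. Qed.

Lemma arr_behead r p x s : arr r p (x :: s) -> arr r p.+1 s.
Proof. by move=> h i si; rewrite addSnnS; apply: h. Qed.

Lemma arr_same X r r' p s : all (gtn 32) X -> 32 <= p -> same X r r' ->
  arr r p s -> arr r' p s.
Proof.
move=> /allP ltX le32 h hr i lti; rewrite h ?hr //.
by apply/negP => /ltX /=; lia.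
Qed.

Lemma upd_eq r i z : upd r i z i = z. Proof. by rewrite /upd eqxx. Qed.
Lemma upd_neq r i z j : j != i -> upd r i z j = r j.
Proof. by rewrite /upd => /negPf ->. Qed.

(** * Loops that print paths, rows and colours *)

Ltac updE := rewrite ?upd_eq; repeat (rewrite upd_neq; last by []; rewrite ?upd_eq).
Ltac one := first [eapply wp_cst | eapply wp_copy; first by []
  | eapply wp_inc; first by [] | eapply wp_printc | eapply wp_print
  | eapply wp_add | eapply wp_sub].
Ltac stp := eapply wp_seq; one.
Ltac samet := repeat first [exact: same_refl | apply: same_upd; first by []].

(* Registers: 1 is n, 2 to 5 are the counters of nested loops, 6 is d, 7 is a test
   value, 8, 9 and 10 are pointers, 11 is the previous colour, 12 and 13 are the next
   and the current weight, 14 is the number of vertices, 15 is k, 16 is the first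
   unused vertex, 17 is a, 18 and 19 are the vertices of a and t, 20 is the last
   vertex of the path, 21 and 22 are auxiliary, 23 counts the numbers read and 24 is
   one more than the largest element of D.  The sorted D starts at 32, followed by T. *)
Definition path_body :=
  print_reg 20 ;; print_reg 16 ;; printc 1 ;; print_reg 16 ;; inc 16 ;; print_reg 16 ;; printc 0 ;;
  copy 20 16 ;; inc 16.

Lemma path_ok w r x y u v :
  r 5 = Posz w -> r 20 = Posz u -> r 16 = Posz v ->
  wp (for_ 5 path_body) (20 * w + 3)
    (fun st => [/\ st.1.2 = x, st.2 = y ++ code (path_edges w u v),
       st.1.1 20 = Posz (path_end w u v), st.1.1 16 = Posz (v + w.*2)
       & same [:: 0; 5; 16; 20] r st.1.1]) (r, x, y).
Proof.
elim: w r y u v => [|w IH] r y u v e5 e20 e16.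
  apply: wp_for0 => //=; rewrite cats0 addn0; split=> //; samet.
eapply wp_bound.
  eapply wp_forS; [by []|exact: e5|].
  do 8 stp; one; rewrite /raise_flag /=.
  eapply wp_weak; first eapply IH; updE.
  - by [].
  - by rewrite e16 -[1%R]/(Posz 1) -PoszD addn1.
  - rewrite e16 -[1%R]/(Posz 1) -!PoszD !addn1. by [].
  move=> st [-> -> -> -> h]; split=> //.
  - rewrite e16 e20. rewrite -!cats1 -!catA /=. rewrite -[1%R]/(Posz 1) -!PoszD !addn1. by [].
  - by rewrite doubleS !addnS.
  - apply: (same_trans h) => //. samet.
lia.
Qed.

(** A jump only tests whether a register is positive, so [x <= y] is tested as [y - x + 1 > 0]. *)
Definition check_edge :=
  Op (SubI 7 6 17) ;; inc 7 ;;
  If 7 (Op (AddI 7 6 17) ;; Op (SubI 7 7 21) ;; inc 7 ;;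
        If 7 (print_reg 18 ;; print_reg 20 ;; printc 0) nop) nop.

Lemma check_edge_ok r x y d a t j u :
  r 6 = Posz d -> r 17 = a -> r 21 = Posz t -> r 18 = Posz j -> r 20 = Posz u ->
  wp check_edge 17
    (fun st => [/\ st.1.2 = x,
       st.2 = y ++ code (if feas d a t then [:: (j, u, 0)] else [::])
       & same [:: 0; 7] r st.1.1]) (r, x, y).
Proof.
move=> e6 e17 e21 e18 e20; eapply wp_bound.
  do 2 stp; eapply wp_if; rewrite /raise_flag /= /feas; updE; rewrite e6 e17.
  have -> : (0 < Posz d - a + 1)%R = (a <= Posz d)%R by lia.
  case: (a <= Posz d)%R => /=.
    do 3 stp; eapply wp_if; rewrite /raise_flag /=; updE; rewrite e6 e17 e21.
    have -> : (0 < Posz d + a - Posz t + 1)%R = (Posz t <= Posz d + a)%R by lia.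
    case: (Posz t <= Posz d + a)%R => /=.
      do 2 stp; one; rewrite /=; updE; rewrite e18 e20 -!cats1 -!catA.
      split=> //; samet.
    apply: (@wp_bound _ 1) => //; one; rewrite /= cats0; split=> //; samet.
  apply: (@wp_bound _ 1) => //; one; rewrite /= cats0; split=> //; samet.
by [].
Qed.

Definition row_body :=
  Op (LoadI 21 10) ;; inc 10 ;; copy 20 19 ;; copy 5 13 ;; for_ 5 path_body ;;
  check_edge ;; inc 19.

Lemma row_ok ts r x y p d a w j l v : 32 <= p -> arr r p ts ->
  r 4 = Posz (size ts) -> r 10 = Posz p -> r 19 = Posz l -> r 13 = Posz w ->
  r 16 = Posz v -> r 6 = Posz d -> r 17 = a -> r 18 = Posz j ->
  wp (for_ 4 row_body) (size ts * (20 * w + 34) + 3)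
    (fun st => [/\ st.1.2 = x,
       st.2 = y ++ code (subdivide_all v (row_vedges d w a j l ts)),
       st.1.1 16 = Posz (vsize v (row_vedges d w a j l ts))
       & same [:: 0; 4; 5; 7; 10; 16; 19; 20; 21] r st.1.1]) (r, x, y).
Proof.
elim: ts r y p l v => [|t ts IH] r y p l v lep ha e4 e10 e19 e13 e16 e6 e17 e18.
  by apply: wp_for0 => //=; rewrite cats0; split=> //; [rewrite upd_neq // /vsize addn0 | samet].
eapply wp_bound.
  eapply wp_forS; [by []|exact: e4|].
  eapply wp_seq; eapply wp_load; [by updE; exact: e10| |].
    by rewrite !upd_neq; [exact: arr_head ha|lia..].
  do 3 stp.
  eapply wp_seq; eapply wp_weak; first eapply path_ok.
  - by updE; exact: e13.
  - by updE; exact: e19.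
  - by updE; exact: e16.
  case=> [[r1 x1] y1] /= [-> -> e20' e16' s1].
  eapply wp_seq; eapply wp_weak; first eapply (@check_edge_ok _ _ _ d a).
  - by rewrite s1 //; updE; exact: e6.
  - by rewrite s1 //; updE; exact: e17.
  - by rewrite s1 //; updE.
  - by rewrite s1 //; updE; exact: e18.
  - exact: e20'.
  case=> [[r2 x2] y2] /= [-> -> s2].
  one; rewrite /raise_flag /=.
  have S : same [:: 0; 4; 5; 7; 10; 16; 19; 20; 21] r
    (upd (upd (upd r2 0 1%R) 19 (r2 19 + 1)%R) 0 1%R).
    do 3 apply: same_upd => //; apply: (same_trans s2) => //.
    apply: (same_trans s1) => //; samet.
  eapply wp_weak; first eapply (IH _ _ p.+1 l.+1).
  - by lia.
  - by apply: (arr_same _ _ S (arr_behead ha)) => //; lia.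
  - by updE; rewrite s2 // s1 //; updE.
  - by updE; rewrite s2 // s1 //; updE; rewrite e10 -[1%R]/(Posz 1) -PoszD addn1.
  - by updE; rewrite s2 // s1 //; updE; rewrite e19 -[1%R]/(Posz 1) -PoszD addn1.
  - by rewrite S.
  - by updE; rewrite s2 // e16'.
  - by rewrite S.
  - by rewrite S.
  - by rewrite S.
  move=> st [-> -> -> h]; split=> //.
  - by rewrite /= !code_cat -!catA /vweight /=.
  - by rewrite /vsize /row_vedges /= doubleD addnA.
  by apply: (same_trans h).
rewrite /=; lia.
Qed.

Definition rows_body :=
  Op (LoadI 21 9) ;; inc 9 ;; cst 0 1 ;; Op (SubI 17 17 0) ;; Op (SubI 7 17 21) ;;
  If 7 (copy 17 21) nop ;;
  cst 0 32 ;; Op (AddI 10 0 1) ;; copy 19 1 ;; copy 4 1 ;; for_ 4 row_body ;; inc 18.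

Lemma min_sub_1 (a : int) d :
  Num.min (a - 1)%R (Posz d) = if (0 < a - 1 - Posz d)%R then Posz d else (a - 1)%R.
Proof. by rewrite minElt; do 2 case: ifP => ?; lia. Qed.

Lemma rows_ok ds ts r x y p d a w j v : 32 <= p -> arr r p ds ->
  arr r (32 + size ts) ts ->
  r 3 = Posz (size ds) -> r 9 = Posz p -> r 1 = Posz (size ts) -> r 13 = Posz w ->
  r 16 = Posz v -> r 6 = Posz d -> r 17 = a -> r 18 = Posz j ->
  wp (for_ 3 rows_body) (size ds * (size ts * (20 * w + 34) + 30) + 3)
    (fun st => let L := colour_vedges d w j (size ts) ts (disc a ds) in
       [/\ st.1.2 = x,
       st.2 = y ++ code (subdivide_all v L),
       st.1.1 16 = Posz (vsize v L)
       & same [:: 0; 3; 4; 5; 7; 9; 10; 16; 17; 18; 19; 20; 21] r st.1.1]) (r, x, y).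
Proof.
elim: ds r y p a j v => [|t ds IH] r y p a j v lep ha ht e3 e9 e1 e13 e16 e6 e17 e18.
  by apply: wp_for0 => //=; rewrite cats0; split=> //; [rewrite upd_neq // /vsize addn0 | samet].
eapply wp_bound.
  eapply wp_forS; [by []|exact: e3|].
  eapply wp_seq; eapply wp_load; [by updE; exact: e9| |].
    by rewrite !upd_neq; [exact: arr_head ha|lia..].
  do 4 stp.
  eapply wp_seq.
  match goal with |- context [upd ?r7 7 ?z] => set r1 := upd r7 7 z end.
  (* One postcondition summarises both branches, so the rest of the round is verified only once. *)
  apply: (@wp_weak _ (2 + 3) (fun st => [/\ st.1.2 = x, st.2 = y,
    st.1.1 17 = Num.min (a - 1)%R (Posz t) & same [:: 0; 17] r1 st.1.1])).
    have c7 : r1 7 = (a - 1 - Posz t)%R by rewrite /r1; updE; rewrite e17.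
    have c17 : r1 17 = (a - 1)%R by rewrite /r1; updE; rewrite e17.
    have c21 : r1 21 = Posz t by rewrite /r1; updE.
    apply: wp_if; rewrite /= c7; case: ifP => lt_t.
      one; split=> //=; [updE; rewrite c21 min_sub_1; case: ifP; lia|samet].
    apply: (@wp_bound _ 1) => //; one; split=> //=; last samet.
    by updE; rewrite c17 min_sub_1; case: ifP; lia.
  case=> [[r2 x2] y2] /= [-> -> e17' s1].
  do 4 stp.
  eapply wp_seq; eapply wp_weak; first eapply (@row_ok ts _ _ _ (32 + size ts) d (Num.min (a - 1)%R (Posz t)) w j (size ts)).
  - by [].
  - apply: (@arr_same [:: 0; 3; 4; 5; 7; 9; 10; 16; 17; 18; 19; 20; 21] r) => //.
    samet.
    apply: (same_trans s1) => //; rewrite /r1; samet.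
  - by updE; rewrite s1 // /r1; updE; exact: e1.
  - by updE; rewrite s1 // /r1; updE; rewrite e1.
  - by updE; rewrite s1 // /r1; updE; exact: e1.
  - by updE; rewrite s1 // /r1; updE; exact: e13.
  - by updE; rewrite s1 // /r1; updE; exact: e16.
  - by updE; rewrite s1 // /r1; updE; exact: e6.
  - by updE; exact: e17'.
  - by updE; rewrite s1 // /r1; updE; exact: e18.
  case=> [[r3 x3] y3] /= [-> -> e16' s2].
  one; rewrite /raise_flag /=.
  have S : same [:: 0; 3; 4; 5; 7; 9; 10; 16; 17; 18; 19; 20; 21] r
    (upd (upd (upd r3 0 1%R) 18 (r3 18 + 1)%R) 0 1%R).
    do 3 apply: same_upd => //; apply: (same_trans s2) => //.
    samet; apply: (same_trans s1) => //; rewrite /r1; samet.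
  eapply wp_weak; first eapply (IH _ _ p.+1 (Num.min (a - 1)%R (Posz t)) j.+1).
  - by lia.
  - by apply: (arr_same _ _ S (arr_behead ha)) => //; lia.
  - by apply: (arr_same _ _ S ht).
  - by updE; rewrite s2 //; updE; rewrite s1 // /r1; updE.
  - by updE; rewrite s2 //; updE; rewrite s1 // /r1; updE; rewrite e9 -[1%R]/(Posz 1) -PoszD addn1.
  - by rewrite S.
  - by rewrite S.
  - by updE; exact: e16'.
  - by rewrite S.
  - by updE; rewrite s2 //; updE; exact: e17'.
  - by updE; rewrite s2 //; updE; rewrite s1 // /r1; updE; rewrite e18 -[1%R]/(Posz 1) -PoszD addn1.
  move=> st [-> -> -> h]; split=> //.
  - by rewrite /= /colour_vedges /= subdivide_all_cat code_cat -!catA.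
  - by rewrite /= /colour_vedges /= vsize_cat.
  by apply: (same_trans h).
rewrite /=; lia.
Qed.

(** * Multiplication by [n] and passes over the colours *)

Definition mul_n x :=
  copy 3 1 ;; cst 22 0 ;; for_ 3 (Op (AddI 22 22 x)) ;; copy x 22.

Lemma mul_loop_ok n r x y i m s : i \notin [:: 0; 3; 22] ->
  r 3 = Posz n -> r 22 = Posz s -> r i = Posz m ->
  wp (for_ 3 (Op (AddI 22 22 i))) (6 * n + 3)
    (fun st => [/\ st.1.2 = x, st.2 = y, st.1.1 22 = Posz (s + m * n)
       & same [:: 0; 3; 22] r st.1.1]) (r, x, y).
Proof.
move=> iX; elim: n r s => [|n IH] r s e3 e22 ei.
  by apply: wp_for0 => //=; split=> //; [updE; rewrite muln0 addn0|samet].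
have [i0 i3 i22] : [/\ i != 0, i != 3 & i != 22].
  by move: iX; rewrite !inE !negb_or => /and3P.
eapply wp_bound.
  eapply wp_forS; [by []|exact: e3|].
  one; rewrite /raise_flag /=.
  eapply wp_weak; first eapply (IH _ (s + m)).
  - by updE.
  - by updE; rewrite e22 ei -PoszD.
  - by rewrite !upd_neq.
  move=> st [-> -> -> h]; split=> //.
  - by rewrite mulnS addnA.
  - apply: (same_trans h) => //; samet.
lia.
Qed.

Lemma mul_ok r x y i m n : i \notin [:: 0; 1; 3; 22] -> r 1 = Posz n -> r i = Posz m ->
  wp (mul_n i) (6 * n + 8)
    (fun st => [/\ st.1.2 = x, st.2 = y, st.1.1 i = Posz (m * n)
       & same [:: 0; 3; 22; i] r st.1.1]) (r, x, y).
Proof.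
move=> iX e1 ei.
have [i0 i1 i3 i22] : [/\ i != 0, i != 1, i != 3 & i != 22].
  by move: iX; rewrite !inE !negb_or => /and4P.
eapply wp_bound.
  do 2 stp.
  eapply wp_seq; eapply wp_weak; first eapply (@mul_loop_ok n _ _ _ _ m 0).
  - by rewrite !inE !negb_or i0 i3.
  - by updE.
  - by updE.
  - by rewrite !upd_neq.
  case=> [[r1 x1] y1] /= [-> -> e22 s1].
  one; split=> //=; first by updE.
  apply: same_upd; first by rewrite !inE eqxx !orbT.
  apply: same_upd => //; apply: (same_trans s1) => //; samet.
lia.
Qed.

(** Register 12 stays one power of [n] ahead of register 13, so the weight of a new colour is ready
    when it is met. Only new colours run [k], which lets the counting pass and the printing pass
    share this code. *)
Definition colour_body k :=
  Op (LoadI 6 8) ;; inc 8 ;; Op (SubI 7 11 6) ;;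
  If 7 (copy 13 12 ;; mul_n 12 ;; copy 11 6 ;; k) nop.

Definition init_colours :=
  copy 2 1 ;; cst 8 32 ;; copy 11 24 ;; cst 12 1.

Lemma colour_new k b Q r x o p d prev wn n : 32 <= p -> r 8 = Posz p ->
  r p = Posz d -> r 11 = Posz prev -> r 12 = Posz wn -> r 1 = Posz n -> d < prev ->
  (forall r', same [:: 0; 3; 6; 7; 8; 11; 12; 13; 22] r r' ->
     r' 8 = Posz p.+1 -> r' 6 = Posz d -> r' 11 = Posz d -> r' 13 = Posz wn ->
     r' 12 = Posz (wn * n) -> wp k b Q (r', x, o)) ->
  wp (colour_body k) (b + 6 * n + 19) Q (r, x, o).
Proof.
move=> lep e8 ep e11 e12 e1 lt_d ok; eapply wp_bound.
  eapply wp_seq; eapply wp_load; [exact: e8|exact: ep|].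
  do 2 stp; eapply wp_if; rewrite /=; updE.
  rewrite e11 ifT; last by lia.
  stp; eapply wp_seq; eapply wp_weak; first eapply (@mul_ok _ _ _ _ wn n) => //.
  case=> [[r1 x1] y1] /= [-> -> e12' s1].
  stp; apply: ok.
  - samet; apply: (same_trans s1) => //; samet.
  - by updE; rewrite s1 //; updE; rewrite e8 -[1%R]/(Posz 1) -PoszD addn1.
  - by updE; rewrite s1 //; updE.
  - by updE; rewrite s1 //; updE.
  - by updE; rewrite s1 //; updE.
  - by updE.
lia.
Qed.

Lemma colour_old k Q r x o p d prev : r 8 = Posz p ->
  r p = Posz d -> r 11 = Posz prev -> prev <= d ->
  (forall r', same [:: 0; 6; 7; 8] r r' -> r' 8 = Posz p.+1 -> Q (r', x, o)) ->
  wp (colour_body k) 8 Q (r, x, o).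
Proof.
move=> e8 ep e11 le_d ok; eapply wp_bound.
  eapply wp_seq; eapply wp_load; [exact: e8|exact: ep|].
  do 2 stp; eapply wp_if; rewrite /=; updE.
  rewrite e11 ifF; last by lia.
  one; apply: ok; first by samet.
  by rewrite /=; updE; rewrite e8 -[1%R]/(Posz 1) -PoszD addn1.
lia.
Qed.

(** The number [k] as the machine accumulates it: [wn] is the weight awaiting the next new colour,
    [w] the weight of the current colour [prev]. *)
Fixpoint weight_sum (n prev wn w : nat) (ds : seq nat) : nat :=
  if ds is d :: ds' then
    if d < prev then wn + weight_sum n d (wn * n) wn ds'
    else w + weight_sum n prev wn w ds'
  else 0.

Definition count_colours :=
  for_ 2 (colour_body (Op (AddI 14 14 13)) ;; Op (AddI 15 15 13)).

Lemma count_colours_ok n ds r x o p prev wn w s k : 32 <= p -> arr r p ds ->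
  r 2 = Posz (size ds) -> r 8 = Posz p -> r 11 = Posz prev -> r 12 = Posz wn ->
  r 13 = Posz w -> r 14 = Posz s -> r 15 = Posz k -> r 1 = Posz n ->
  wp count_colours (size ds * (6 * n + 26) + 3)
    (fun st => [/\ st.1.2 = x, st.2 = o,
       st.1.1 14 = Posz (s + sumn (map snd (colours n prev wn ds))),
       st.1.1 15 = Posz (k + weight_sum n prev wn w ds)
       & same [:: 0; 2; 3; 6; 7; 8; 11; 12; 13; 14; 15; 22] r st.1.1]) (r, x, o).
Proof.
elim: ds r p prev wn w s k => [|d ds IH] r p prev wn w s k lep ha e2 e8 e11 e12 e13 e14 e15 e1.
  apply: wp_for0 => //=; rewrite !addn0; split=> //; samet.
eapply wp_bound.
  eapply wp_forS; [by []|exact: e2|].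
  eapply wp_seq; have [lt_d|le_d] := ltnP d prev.
    eapply (@colour_new _ 1 _ _ _ _ p d prev wn n).
    - by [].
    - by updE.
    - by rewrite !upd_neq; [exact: arr_head ha|lia..].
    - by updE.
    - by updE.
    - by updE.
    - by [].
    move=> r1 s1 e8' e6' e11' e13' e12'.
    one; one; rewrite /raise_flag /=.
    have S : same [:: 0; 2; 3; 6; 7; 8; 11; 12; 13; 14; 15; 22] r
      (upd (upd (upd r1 14 (r1 14 + r1 13)%R) 15
         (upd r1 14 (r1 14 + r1 13) 15 + upd r1 14 (r1 14 + r1 13) 13)%R) 0 1%R).
      samet; apply: (same_trans s1) => //; samet.
    eapply wp_weak; first eapply (IH _ p.+1 d (wn * n) wn (s + wn) (k + wn)).
    - by lia.
    - by apply: (arr_same _ _ S (arr_behead ha)) => //; lia.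
    - by updE; rewrite s1 //; updE.
    - by updE.
    - by updE.
    - by updE.
    - by updE.
    - by updE; rewrite s1 // e13'; updE; rewrite e14 -PoszD.
    - by updE; rewrite s1 // e13'; updE; rewrite e15 -PoszD.
    - by rewrite S.
    move=> st [-> -> -> -> h]; split=> //.
    - by rewrite /= lt_d /= addnA.
    - by rewrite /= lt_d /= addnA.
    by apply: (same_trans h).
  apply: (@wp_bound _ 8); last by lia.
  eapply (@colour_old _ _ _ _ _ p d prev).
  - by updE.
  - by rewrite !upd_neq; [exact: arr_head ha|lia..].
  - by updE.
  - by [].
  move=> r1 s1 e8'.
  one; rewrite /raise_flag /=.
  have S : same [:: 0; 2; 3; 6; 7; 8; 11; 12; 13; 14; 15; 22] r
    (upd (upd r1 15 (r1 15 + r1 13)%R) 0 1%R).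
    samet; apply: (same_trans s1) => //; samet.
  eapply wp_weak; first eapply (IH _ p.+1 prev wn w s (k + w)).
  - by lia.
  - by apply: (arr_same _ _ S (arr_behead ha)) => //; lia.
  - by updE; rewrite s1 //; updE.
  - by updE.
  - by updE; rewrite s1 //; updE.
  - by updE; rewrite s1 //; updE.
  - by updE; rewrite s1 //; updE.
  - by updE; rewrite s1 //; updE.
  - by updE; rewrite !s1 //; updE; rewrite e15 e13 -PoszD.
  - by rewrite S.
  move=> st [-> -> -> -> h]; split=> //.
  - by rewrite /= ltnNge le_d.
  - by rewrite /= ltnNge le_d /= addnA.
  by apply: (same_trans h).
rewrite /=; lia.
Qed.

Definition colour_edges :=
  copy 17 24 ;; cst 18 0 ;; cst 9 32 ;; copy 3 1 ;; for_ 3 rows_body.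

Definition print_edges := for_ 2 (colour_body colour_edges).

Definition all_vedges n ts As cs : seq vedge :=
  flatten [seq colour_vedges c.1 c.2 0 n ts As | c <- cs].

Lemma print_edges_ok n Ds ts ds r x o p prev wn v a : n = size Ds -> n = size ts ->
  arr r 32 Ds -> arr r (32 + n) ts ->  r 24 = a ->
  32 <= p -> arr r p ds ->
  r 2 = Posz (size ds) -> r 8 = Posz p -> r 11 = Posz prev -> r 12 = Posz wn ->
  r 16 = Posz v -> r 1 = Posz n ->
  wp print_edges
    (sumn [seq n * (n * (20 * c.2 + 34) + 36) | c <- colours n prev wn ds] + size ds * 40 + 3)
    (fun st => st.2 = o ++ code (subdivide_all v
       (all_vedges n ts (disc a Ds) (colours n prev wn ds)))) (r, x, o).
Proof.
move=> eD eT.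
elim: ds r o p prev wn v => [|d ds IH] r o p prev wn v hD hT ea lep ha e2 e8 e11 e12 e16 e1.
  by apply: wp_for0 => //=; rewrite cats0.
rewrite /=; have [lt_d|le_d] := ltnP d prev.
  eapply wp_bound.
    eapply wp_forS; [by []|exact: e2|].
    eapply (@colour_new _ _ _ _ _ _ p d prev wn n).
    - by [].
    - by updE.
    - by rewrite !upd_neq; [exact: arr_head ha|lia..].
    - by updE.
    - by updE.
    - by updE.
    - by [].
    move=> r1 s1 e8' e6' e11' e13' e12'.
    do 4 stp.
    have S1 : same [:: 0; 2; 3; 6; 7; 8; 11; 12; 13; 22] r r1.
      apply: (same_trans s1) => //; samet.
    match goal with |- wp _ _ _ (?r', _, _) => set r2 := r' end.
    have S2 : same [:: 0; 3; 9; 17; 18] r1 r2 by rewrite /r2; samet.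
    have S : same [:: 0; 2; 3; 6; 7; 8; 9; 11; 12; 13; 17; 18; 22] r r2.
      by apply: (same_trans S2) => //; apply: (same_subset S1).
    eapply wp_weak; first eapply (@rows_ok Ds ts _ _ _ 32 d a wn 0 v).
    - by [].
    - by apply: (arr_same _ _ S hD).
    - by rewrite -eT; apply: (arr_same _ _ S hT).
    - by rewrite /r2; updE; rewrite S1 // e1 eD.
    - by rewrite /r2; updE.
    - by rewrite S // e1 eT.
    - by rewrite S2.
    - by rewrite S.
    - by rewrite S2.
    - by rewrite /r2; updE; rewrite S1.
    - by rewrite /r2; updE.
    case=> [[r3 x3] y3] /= [-> -> e16' s3]; rewrite /raise_flag /=.
    have S3 : same [:: 0; 2; 3; 4; 5; 6; 7; 8; 9; 10; 11; 12; 13; 16; 17; 18; 19; 20; 21; 22] r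
       (upd r3 0 1%R).
      by apply: same_upd => //; apply: (same_trans s3) => //; apply: (same_subset S).
    eapply wp_weak; first eapply (IH _ _ p.+1 d (wn * n) _).
    - by apply: (arr_same _ _ S3 hD).
    - by apply: (arr_same _ _ S3 hT) => //; lia.
    - by rewrite S3.
    - by lia.
    - by apply: (arr_same _ _ S3 (arr_behead ha)) => //; lia.
    - by updE; rewrite s3 // S2 // s1 //; updE.
    - by updE; rewrite s3 // S2 //.
    - by updE; rewrite s3 // S2 //.
    - by updE; rewrite s3 // S2 //.
    - by updE; exact: e16'.
    - by rewrite S3.
    move=> st ->.
    by rewrite /all_vedges /= subdivide_all_cat code_cat -!catA -eT.
  rewrite /= -eD -eT; lia.
eapply wp_bound.
  eapply wp_forS; [by []|exact: e2|].
  eapply (@colour_old _ _ _ _ _ p d prev).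
  - by updE.
  - by rewrite !upd_neq; [exact: arr_head ha|lia..].
  - by updE.
  - by [].
  move=> r1 s1 e8'; rewrite /raise_flag /=.
  have S : same [:: 0; 2; 6; 7; 8] r (upd r1 0 1%R).
    samet; apply: (same_trans s1) => //; samet.
  eapply wp_weak; first eapply (IH _ _ p.+1 prev wn v).
  - by apply: (arr_same _ _ S hD).
  - by apply: (arr_same _ _ S hT) => //; lia.
  - by rewrite S.
  - by lia.
  - by apply: (arr_same _ _ S (arr_behead ha)) => //; lia.
  - by updE; rewrite s1 //; updE.
  - by updE.
  - by rewrite S.
  - by rewrite S.
  - by rewrite S.
  - by rewrite S.
  by move=> st.
rewrite /=; lia.
Qed.

Fixpoint ins (z : nat) (s : seq nat) : seq nat :=
  if s is d :: s' then maxn z d :: ins (minn z d) s' else [:: z].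

Lemma size_ins z s : size (ins z s) = (size s).+1.
Proof. by elim: s z => //= d s IH z; rewrite IH. Qed.

(** One compare-and-swap: the larger element stays in the cell and the smaller one is carried on in
    register 6. There is no early exit, so the number of rounds is known beforehand. *)
Definition ins_body :=
  Op (LoadI 7 8) ;; Op (SubI 21 6 7) ;; If 21 (Op (StoreI 8 6) ;; copy 6 7) nop ;;
  inc 8.

(** The frame condition for code that also writes to memory from address [p] on. *)
Definition below p (X : seq nat) (r r' : nat -> int) :=
  forall i, i < p -> i \notin X -> r' i = r i.

(** After the loop the last element is still carried in register 6; the array is complete only after
    the final store, hence the nested [wp]. *)
Lemma ins_ok s r x o p z : 32 <= p -> arr r p s ->
  r 3 = Posz (size s) -> r 8 = Posz p -> r 6 = Posz z ->
  wp (for_ 3 ins_body) (15 * size s + 3)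
    (wp (Op (StoreI 8 6)) 1
      (fun st => [/\ st.1.2 = x, st.2 = o, arr st.1.1 p (ins z s)
         & below p [:: 0; 3; 6; 7; 8; 21] r st.1.1])) (r, x, o).
Proof.
elim: s r p z => [|d s IH] r p z lep ha e3 e8 e6.
  apply: wp_for0 => //; rewrite /raise_flag /=.
  eapply wp_store; first by updE; exact: e8.
  split=> //=; first by case=> // _; rewrite addn0; updE.
  by move=> i lt_i; rewrite !inE !negb_or => /and5P [i0 i3 i6 i7 _]; rewrite !upd_neq //; lia.
eapply wp_bound.
  eapply wp_forS; [by []|exact: e3|].
  eapply wp_seq; eapply wp_load; [by updE; exact: e8| |].
    by rewrite !upd_neq; [exact: arr_head ha|lia..].
  stp; eapply wp_seq.
  match goal with |- wp _ _ _ (?r', _, _) => set r1 := r' end.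
  apply: (@wp_weak _ (3 + 3) (fun st => [/\ st.1.2 = x, st.2 = o,
    st.1.1 6 = Posz (minn z d), st.1.1 p = Posz (maxn z d) &
    forall i, i != p -> i \notin [:: 0; 6] -> st.1.1 i = r1 i])).
    have c21 : r1 21 = (Posz z - Posz d)%R by rewrite /r1; updE; rewrite e6.
    have c6 : r1 6 = Posz z by rewrite /r1; updE.
    have c7 : r1 7 = Posz d by rewrite /r1; updE.
    have cp : r1 p = Posz d by rewrite /r1 !upd_neq; [exact: arr_head ha|lia..].
    have [p0 p6 p7] : [/\ p != 0, p != 6 & 7 != p] by split; lia.
    apply: wp_if; rewrite /= c21; case: ifP => lt_d.
      apply: (wp_seq (b1 := 1) (b2 := 2)); eapply wp_store; first by rewrite /r1; updE; exact: e8.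
      one; split=> //=.
      - by rewrite upd_eq upd_neq // c7; congr Posz; lia.
      - by rewrite upd_neq // upd_neq // upd_eq c6; congr Posz; lia.
      by move=> i ip; rewrite !inE !negb_or => /andP [i0 i6]; rewrite !upd_neq.
    apply: (@wp_bound _ 1) => //; one; split=> //=.
    - by rewrite !upd_neq // c6; congr Posz; lia.
    - by rewrite !upd_neq // cp; congr Posz; lia.
    by move=> i ip; rewrite !inE !negb_or => /andP [i0 i6]; rewrite !upd_neq.
  case=> [[r2 x2] y2] /= [-> -> e6' ep s1].
  have nep i : i < 32 -> i != p by lia.
  one; rewrite /raise_flag /=.
  eapply wp_weak; first eapply (IH _ p.+1 (minn z d)).
  - by lia.
  - move=> i lt_i; rewrite !upd_neq ?s1 ?inE /r1 ?upd_neq; try lia.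
    by rewrite addSnnS; apply: ha.
  - by updE; rewrite s1 ?nep // /r1; updE.
  - by updE; rewrite s1 ?nep // /r1; updE; rewrite e8 -[1%R]/(Posz 1) -PoszD addn1.
  - by updE.
  case=> [[r3 x3] y3] /= [[[r4 x4] y4] [t [ev le_t [/= ex4 ey4 hs hb]]]].
  exists (r4, x4, y4), t; split=> //; split=> //=.
    case=> [_|i]; last by rewrite addnS -addSn ltnS; apply: hs.
    by rewrite addn0 hb; [rewrite !upd_neq; [exact: ep|lia..]|lia|rewrite !inE; lia].
  move=> i lt_i iX; rewrite hb //; last by lia.
  move: iX; rewrite !inE !negb_or => /and5P [i0 i3 i6 i7 /andP [i8 i21]].
  rewrite !upd_neq // s1 ?inE ?negb_or ?i0 ?i6 //; last by lia.
  by rewrite /r1 !upd_neq.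
rewrite /=; lia.
Qed.

Lemma below_arr r r' p q X s : below q X r r' -> all (gtn 32) X -> 32 <= p ->
  p + size s <= q -> arr r p s -> arr r' p s.
Proof.
move=> h /allP ltX le32 lq hr i lti; rewrite h ?hr //; first by lia.
by apply/negP => /ltX /=; lia.
Qed.

Lemma arr_upd r p s i z : i < p -> arr r p s -> arr (upd r i z) p s.
Proof. by move=> lt_i h k lt_k; rewrite upd_neq ?h //; lia. Qed.

Definition read_D_body :=
  Op (ReadI 6) ;; cst 8 32 ;; copy 3 23 ;; for_ 3 ins_body ;; Op (StoreI 8 6) ;; inc 23.

Lemma read_D_ok ds r x o s : arr r 32 s ->
  r 2 = Posz (size ds) -> r 23 = Posz (size s) ->
  wp (for_ 2 read_D_body) (size ds * (15 * (size s + size ds) + 20) + 3)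
    (fun st => [/\ st.1.2 = x, st.2 = o,
         arr st.1.1 32 (foldl (fun s z => ins z s) s ds)
         & below 32 [:: 0; 2; 3; 6; 7; 8; 21; 23] r st.1.1])
    (r, map Posz ds ++ x, o).
Proof.
elim: ds r s => [|d ds IH] r s ha e2 e23.
  apply: wp_for0 => //; split=> //=.
  by move=> i _; rewrite !inE !negb_or => /andP [i0 _]; rewrite upd_neq.
eapply wp_bound.
  eapply wp_forS; [by []|exact: e2|].
  eapply wp_seq; eapply wp_read; do 2 stp.
  match goal with |- wp _ _ _ (?r', _, _) => set r1 := r' end.
  have S1 : same [:: 0; 2; 3; 6; 8] r r1 by rewrite /r1; samet.
  eapply wp_seq; eapply wp_weak; first eapply (@ins_ok s _ _ _ 32 d).
  - by [].
  - by apply: (arr_same _ _ S1 ha).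
  - by rewrite /r1; updE.
  - by rewrite /r1; updE.
  - by rewrite /r1; updE.
  move=> st h; eapply wp_seq; eapply wp_weak; first exact: h.
  case=> [[r2 x2] y2] /= [-> -> hi hb].
  one; rewrite /raise_flag /=.
  eapply wp_weak; first eapply (IH _ (ins d s)).
  - by do 3 apply: arr_upd => //.
  - by updE; rewrite hb // /r1; updE.
  - by updE; rewrite hb // /r1; updE; rewrite e23 size_ins -[1%R]/(Posz 1) -PoszD addn1.
  case=> [[r3 x3] y3] /= [-> -> h3 hb3]; split=> // i lt_i iX.
  rewrite hb3 //; move: iX; rewrite !inE !negb_or.
  move=> /and5P [i0 i2 i3 i6 /and4P [i7 i8 i21 i23]].
  rewrite !upd_neq // hb ?inE ?negb_or ?i0 ?i3 ?i6 ?i7 ?i8 ?i21 //.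
  by rewrite S1 // !inE !negb_or i0 i2 i3 i6 i8.
rewrite size_ins /=; nia.
Qed.

Definition read_T_body := Op (ReadI 6) ;; Op (StoreI 8 6) ;; inc 8.

Lemma read_T_ok ts r x o p : 32 <= p ->
  r 2 = Posz (size ts) -> r 8 = Posz p ->
  wp (for_ 2 read_T_body) (size ts * 9 + 3)
    (fun st => [/\ st.1.2 = x, st.2 = o, arr st.1.1 p ts
         & below p [:: 0; 2; 6; 8] r st.1.1])
    (r, map Posz ts ++ x, o).
Proof.
elim: ts r p => [|t ts IH] r p lep e2 e8.
  apply: wp_for0 => //; split=> //=.
  by move=> i _; rewrite !inE !negb_or => /andP [i0 _]; rewrite upd_neq.
eapply wp_bound.
  eapply wp_forS; [by []|exact: e2|].
  eapply wp_seq; eapply wp_read; eapply wp_seq; eapply wp_store; first by updE; exact: e8.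
  one; rewrite /raise_flag /=.
  have nep i : i < 32 -> i != p by lia.
  eapply wp_weak; first eapply (IH _ p.+1).
  - by lia.
  - by updE; rewrite upd_neq ?nep //; updE.
  - updE; rewrite upd_neq ?nep //; updE; rewrite e8 -[1%R]/(Posz 1) -PoszD addn1 //.
  case=> [[r3 x3] y3] /= [-> -> h3 hb3]; split=> //.
    case=> [_|i]; last by rewrite addnS -addSn ltnS; apply: h3.
    rewrite addn0 hb3; [|lia|rewrite !inE; lia].
    rewrite 3?[LHS]upd_neq; try lia; rewrite upd_eq; updE; by [].
  move=> i lt_i iX; rewrite hb3 //; last by lia.
  move: iX; rewrite !inE !negb_or => /and4P [i0 i2 i6 i8].
  by rewrite !upd_neq //; lia.
rewrite /=; lia.
Qed.

Definition prog :=
  Op (ReadI 1) ;; copy 2 1 ;; for_ 2 read_D_body ;;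
  cst 8 32 ;; Op (AddI 8 8 1) ;; copy 2 1 ;; for_ 2 read_T_body ;;
  cst 8 32 ;; Op (LoadI 24 8) ;; inc 24 ;;
  init_colours ;; cst 13 0 ;; cst 14 0 ;; cst 15 0 ;; count_colours ;;
  mul_n 14 ;; mul_n 14 ;; Op (AddI 14 14 1) ;; Op (AddI 14 14 14) ;; print_reg 14 ;; print_reg 15 ;;
  copy 16 1 ;; Op (AddI 16 16 16) ;; init_colours ;; print_edges.

Definition sort_desc (ds : seq nat) := foldl (fun s z => ins z s) [::] ds.

Lemma size_sort_desc ds : size (sort_desc ds) = size ds.
Proof.
suff H s : size (foldl (fun s z => ins z s) s ds) = size s + size ds by apply: H.
by elim: ds s => [|d ds IH] s; rewrite /= ?addn0 // IH size_ins addSnnS.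
Qed.

(** The sentinel [d0], one more than the largest element of [D], serves twice: as the previous
    colour it makes the head of [Ds] a new colour, and as the value before the discretized sequence
    it gives [min (d0 - 1) d = d] at the head. *)
Lemma prog_ok n (ds ts : seq nat) : 0 < n -> size ds = n -> size ts = n ->
  let Ds := sort_desc ds in
  let d0 := (head 0 Ds).+1 in
  let cs := colours n d0 1 Ds in
  let S := sumn (map snd cs) in
  wp prog (21 * n * n + 200 * n + 200 +
     sumn [seq n * (n * (20 * c.2 + 34) + 36) | c <- cs])
    (fun st => st.2 = Posz (S * n * n + n).*2 :: Posz (weight_sum n d0 1 0 Ds) ::
       code (subdivide_all n.*2 (all_vedges n ts (disc (Posz d0) Ds) cs)))
    (fun=> 0%R, Posz n :: map Posz ds ++ map Posz ts, [::]).
Proof.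
move=> n0 sD sT Ds d0 cs S.
have sDs : size Ds = n by rewrite size_sort_desc.
have hDs : Ds = d0.-1 :: behead Ds by rewrite /d0; case: (Ds) sDs n0 => [<-|].
eapply wp_bound.
  eapply wp_seq; eapply wp_read; stp.
  eapply wp_seq; eapply wp_weak; first eapply (@read_D_ok ds _ (map Posz ts) _ [::]).
  - by [].
  - by updE; rewrite sD.
  - by [].
  case=> [[r1 x1] y1] /= [-> -> h1 b1].
  have e1 : r1 1 = Posz n by rewrite b1.
  do 3 stp.
  rewrite -[map Posz ts]cats0.
  eapply wp_seq; eapply wp_weak; first eapply (@read_T_ok ts _ [::] _ (32 + n)).
  - by lia.
  - by updE; rewrite e1 sT.
  - by updE; rewrite e1 -PoszD.
  case=> [[r2 x2] y2] /= [-> -> h2 b2].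
  have hD2 : arr r2 32 Ds.
    apply: (below_arr b2) => //; first by rewrite sDs.
  have e1' : r2 1 = Posz n by rewrite b2; [updE|lia|].
  stp; eapply wp_seq; eapply (@wp_load _ _ _ _ _ _ 32 (Posz d0.-1)); first by updE.
    by rewrite !upd_neq //; move: hD2; rewrite hDs => /arr_head.
  stp; eapply wp_seq; do 3 stp; one; do 3 stp.
  match goal with |- wp _ _ _ (?r', _, _) => set r3 := r' end.
  have S3 : same [:: 0; 2; 8; 11; 12; 13; 14; 15; 24] r2 r3 by rewrite /r3; samet.
  have d0E : (Posz d0.-1 + 1)%R = Posz d0 by rewrite -[1%R]/(Posz 1) -PoszD addn1.
  eapply wp_seq; eapply wp_weak; first eapply (@count_colours_ok n Ds _ _ _ 32 d0 1 0 0 0).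
  - by [].
  - by apply: (arr_same _ _ S3 hD2).
  - by rewrite /r3; updE; rewrite e1' sDs.
  - by rewrite /r3; updE.
  - by rewrite /r3; updE; rewrite d0E.
  - by rewrite /r3; updE.
  - by rewrite /r3; updE.
  - by rewrite /r3; updE.
  - by rewrite /r3; updE.
  - by rewrite S3.
  case=> [[r4 x4] y4] /= [-> -> e14 e15 s4].
  eapply wp_seq; eapply wp_weak; first eapply (@mul_ok _ _ _ _ S n) => //.
  - by rewrite s4 // S3.
  case=> [[r5 x5] y5] /= [-> -> e14' s5].
  eapply wp_seq; eapply wp_weak; first eapply (@mul_ok _ _ _ _ (S * n) n) => //.
  - by rewrite s5 // s4 // S3.
  case=> [[r6 x6] y6] /= [-> -> e14'' s6].
  do 6 stp; eapply wp_seq; do 3 stp; one.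
  rewrite /print_edges.
  match goal with |- wp _ _ _ (?r', _, _) => set r7 := r' end.
  have S7 : same [:: 0; 2; 3; 6; 7; 8; 11; 12; 13; 14; 15; 16; 22; 24] r2 r7.
    rewrite /r7; samet.
    apply: (same_trans s6) => //; apply: (same_trans s5) => //.
    apply: (same_trans s4) => //; exact: (same_subset S3).
  have e24 : r6 24 = Posz d0.
    by rewrite s6 // s5 // s4 // /r3; updE; rewrite d0E.
  have e1'' : r6 1 = Posz n by rewrite s6 // s5 // s4 // S3.
  eapply wp_weak; first eapply (@print_edges_ok n Ds ts Ds _ _ _ 32 d0 1 n.*2 (Posz d0)).
  - by [].
  - by [].
  - by apply: (arr_same _ _ S7 hD2).
  - by apply: (arr_same _ _ S7 h2) => //; lia.
  - by rewrite /r7; updE.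
  - by [].
  - by apply: (arr_same _ _ S7 hD2).
  - by rewrite /r7; updE; rewrite e1'' sDs.
  - by rewrite /r7; updE.
  - by rewrite /r7; updE.
  - by rewrite /r7; updE.
  - by rewrite /r7; updE; rewrite e1'' -PoszD addnn.
  - by rewrite S7.
  move=> st ->; updE.
  rewrite e14'' e1'' s6 // s5 // e15 -!PoszD addnn /=. by [].
rewrite -/cs sD sT sDs /=; set X := sumn _; nia.
Qed.

(** * Matchings of weighted multigraphs *)

Definition incidence (v : nat) (e : edge) : nat := (e.1.1 == v) + (e.1.2 == v).

(** Edges are selected by position, which keeps parallel edges apart. *)
Definition weighted_matching (N : nat) (L : seq edge) (k : nat) : Prop :=
  exists m : bitseq, [/\ size m = size L,
    forall v, v < N -> \sum_(e <- mask m L) incidence v e = 1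
    & \sum_(e <- mask m L) e.2 = k].

Definition edges_below N (L : seq edge) := all (fun e => (e.1.1 < N) && (e.1.2 < N)) L.

Lemma edges_below_cat N L1 L2 :
  edges_below N (L1 ++ L2) = edges_below N L1 && edges_below N L2.
Proof. exact: all_cat. Qed.

Lemma edges_below_leq N N' L : N <= N' -> edges_below N L -> edges_below N' L.
Proof. by move=> le; apply: sub_all => e; lia. Qed.

Lemma incidence_below N L m v : edges_below N L -> N <= v ->
  \sum_(e <- mask m L) incidence v e = 0.
Proof.
move=> /allP h le; rewrite big_seq big1 // => e /mem_mask /h.
rewrite /incidence; lia.
Qed.

Definition optional (b : bool) (e : edge) := if b then [:: e] else [::].

Lemma mask_split (T : Type) (m : bitseq) (s1 s2 : seq T) :
  size m = size (s1 ++ s2) ->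
  exists m1 m2, [/\ m = m1 ++ m2, size m1 = size s1 & size m2 = size s2].
Proof.
rewrite size_cat => e; exists (take (size s1) m), (drop (size s1) m).
by rewrite cat_take_drop size_takel ?size_drop ?e ?addKn ?leq_addr.
Qed.

(** The edge from [u] to [a] becomes the path [u, v, v.+1, a] with weights 1, 0 and [w]. Let [b']
    tell whether the edge at [a] is present and selected. Covering [v] and [v.+1] forces
    [b1 + b2 = 1] and [b2 + b' = 1], hence [b1 = b']: either both outer edges are selected or the
    middle one alone, so [u] and [a] are covered and the weight is counted as by the single edge. *)
Lemma subdivision_step v P R a u w f k :
  edges_below v P -> edges_below v R -> a < v -> u < v ->
  weighted_matching v (P ++ optional f (a, u, w.+1) ++ R) k <->
  weighted_matching v.+2
    (P ++ [:: (u, v, 1); (v, v.+1, 0)] ++ optional f (a, v.+1, w) ++ R) k.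
Proof.
move=> bP bR av uv; split=> -[m [sm cov wt]].
  have [m1 [m' [em s1 s']]] := mask_split sm.
  have [m0 [m2 [em' s0 s2]]] := mask_split s'.
  have [b m0E] : exists b, m0 = if f then [:: b] else [::].
    by exists (head true m0); case: (f) s0; case: (m0) => [|? [|? ?]].
  pose b' := f && b.
  exists (m1 ++ [:: b'; ~~ b'] ++ m0 ++ m2).
  have em2 : mask (m1 ++ [:: b'; ~~ b'] ++ m0 ++ m2)
    (P ++ [:: (u, v, 1); (v, v.+1, 0)] ++ optional f (a, v.+1, w) ++ R) =
    mask m1 P ++ (nseq b' (u, v, 1) ++ nseq (~~ b') (v, v.+1, 0)) ++
    nseq b' (a, v.+1, w) ++ mask m2 R.
    rewrite !mask_cat //; last by rewrite s0; case: (f).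
    by rewrite m0E /b'; case: (f); case: (b).
  have em1 : mask m (P ++ optional f (a, u, w.+1) ++ R) =
    mask m1 P ++ nseq b' (a, u, w.+1) ++ mask m2 R.
    rewrite em em' !mask_cat //.
    by rewrite m0E /b'; case: (f); case: (b).
  rewrite em2; rewrite em1 in cov wt; split.
  - by rewrite !size_cat s1 s2 s0 /=; case: (f).
  - move=> x lx; rewrite !big_cat /=.
    have [xv|vx] := ltnP x v.
      have := cov x xv; rewrite !big_cat /=.
      by case: (b'); rewrite /= ?big_cons !big_nil /incidence /=; lia.
    rewrite !(incidence_below _ bP) ?(incidence_below _ bR) //.
    by case: (b'); rewrite /= ?big_cons !big_nil /incidence /=; lia.
  - move: wt; rewrite !big_cat /=.
    by case: (b'); rewrite /= ?big_cons !big_nil /=; lia.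
have [m1 [m' [em s1 s']]] := mask_split sm.
have [m3 [m'' [em' s3 s'']]] := mask_split s'.
have [m0 [m2 [em'' s0 s2]]] := mask_split s''.
case: m3 s3 em' => [|b1 [|b2 [|? ?]]] // _ em'.
have [b m0E] : exists b, m0 = if f then [:: b] else [::].
  by exists (head true m0); case: (f) s0; case: (m0) => [|? [|? ?]].
pose b' := f && b.
have em2 : mask m
    (P ++ [:: (u, v, 1); (v, v.+1, 0)] ++ optional f (a, v.+1, w) ++ R) =
    mask m1 P ++ (nseq b1 (u, v, 1) ++ nseq b2 (v, v.+1, 0)) ++
    nseq b' (a, v.+1, w) ++ mask m2 R.
  rewrite em em' em'' !mask_cat // m0E /b'.
  by case: (f); case: (b); case: (b1); case: (b2).
have em1 : mask (m1 ++ m0 ++ m2) (P ++ optional f (a, u, w.+1) ++ R) =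
  mask m1 P ++ nseq b' (a, u, w.+1) ++ mask m2 R.
  rewrite !mask_cat //; last by rewrite s0; case: (f).
  by rewrite m0E /b'; case: (f); case: (b).
rewrite em2 in cov wt.
have c1 : b1 + b2 = 1.
  have := cov v (leqnSn _); rewrite !big_cat /=.
  rewrite (incidence_below _ bP) ?(incidence_below _ bR) //.
  by case: (b'); case: (b1); case: (b2); rewrite /= ?big_cons !big_nil /incidence /=; lia.
have c2 : b2 + b' = 1.
  have := cov v.+1 (leqnn _); rewrite !big_cat /=.
  rewrite (incidence_below _ bP) ?(incidence_below _ bR) //.
  by case: (b'); case: (b1); case: (b2); rewrite /= ?big_cons !big_nil /incidence /=; lia.
exists (m1 ++ m0 ++ m2); rewrite em1; split.
- by rewrite !size_cat s1 s2 s0; case: (f).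
- move=> x xv; have := cov x (leq_trans xv (leqW (leqnSn v))); rewrite !big_cat /=.
  by move: c1 c2; case: (b'); case: (b1); case: (b2); rewrite /= ?big_cons !big_nil /incidence /=; lia.
- move: wt; rewrite !big_cat /=.
  by move: c1 c2; case: (b'); case: (b1); case: (b2); rewrite /= ?big_cons !big_nil /=; lia.
Qed.

(** Each unit of weight is one [subdivision_step]: its two new edges join the prefix, and the edge
    left to subdivide starts at [v.+1]. *)
Lemma subdivide_matching w u v P R a f k :
  edges_below v P -> edges_below v R -> a < v -> u < v ->
  weighted_matching v (P ++ optional f (a, u, w) ++ R) k <->
  weighted_matching (v + w.*2) (P ++ subdivide (a, u, w, f) v ++ R) k.
Proof.
elim: w u v P => [|w IH] u v P bP bR av uv; first by rewrite addn0.
apply: (iff_trans (@subdivision_step v P R a u w f k bP bR av uv)).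
have := IH v.+1 v.+2 (P ++ [:: (u, v, 1); (v, v.+1, 0)]).
rewrite -!catA !addSn doubleS !addnS => h.
apply: (iff_trans (h _ _ _ _)) => //; last 2 first.
- by apply: edges_below_leq bR; lia.
- by lia.
- by rewrite edges_below_cat (edges_below_leq _ bP) /=; lia.
Qed.

Definition virtual_edges (L : seq vedge) : seq edge := [seq e.1 | e <- L & e.2].

Lemma subdivide_all_matching L v P k : edges_below v P -> edges_below v (map fst L) ->
  weighted_matching v (P ++ virtual_edges L) k <->
  weighted_matching (vsize v L) (P ++ subdivide_all v L) k.
Proof.
elim: L v P => [|[[[a u] w] f] L IH] v P bP; first by rewrite /vsize addn0.
rewrite /= -/edges_below => /andP [/andP [av uv] bL].
have -> : virtual_edges ((a, u, w, f) :: L) = optional f (a, u, w) ++ virtual_edges L.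
  by rewrite /virtual_edges /=; case: f.
have bV : edges_below v (virtual_edges L).
  apply/allP => e /mapP [x]; rewrite mem_filter => /andP [_ xL] ->.
  by move/allP: bL; apply; apply: map_f.
apply: (iff_trans (@subdivide_matching w u v P _ a f k bP bV av uv)); rewrite catA.
apply: (iff_trans (IH _ _ _ _)).
- rewrite edges_below_cat (edges_below_leq _ bP) ?leq_addr //=.
  elim: w u v {bP bL bV} av uv => [|w IHw] u v av uv.
    by rewrite addn0 /=; case: (f); rewrite //= av uv.
  rewrite /= -/edges_below.
  have := IHw v.+1 v.+2; rewrite !addSn !addnS => ->; lia.
- by apply: edges_below_leq bL; rewrite leq_addr.
by rewrite -catA /vsize /= doubleD addnA.
Qed.

(** * From edge lists to instances of Exact Matching *)

Section Instance.
Variables (N : nat) (E : seq edge) (k : nat).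
Hypothesis lt_ends : all (fun e => (e.1.1 < e.1.2 < N.+1) && (e.2 <= 1)) E.
Hypothesis uniq_ends : uniq (map fst E).
Hypothesis k_gt0 : 0 < k.

Let ends (e : edge) : {set 'I_N.+1} := [set inord e.1.1; inord e.1.2].
Let es : seq ('I_N.+1 * 'I_N.+1 * bool) :=
  [seq (inord e.1.1, inord e.1.2, e.2 == 1) | e <- E].

Let endsP e : e \in E -> [/\ e.1.1 < e.1.2, e.1.1 < N.+1, e.1.2 < N.+1 & e.2 <= 1].
Proof. by move/(allP lt_ends) => /andP [/andP [h1 h2] h3]; split=> //; apply: ltn_trans h2. Qed.

Let in_ends e v : e \in E -> v < N.+1 -> (inord v \in ends e) = (v == e.1.1) || (v == e.1.2).
Proof.
by move=> /endsP [_ h1 h2 _] hv; rewrite !inE -!val_eqE /= !inordK.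
Qed.

Let ends_inj : {in E &, injective ends}.
Proof.
move=> e f eE fE eq_ef.
have [e12 e1 e2 _] := endsP eE; have [f12 f1 f2 _] := endsP fE.
have := in_ends fE e1; rewrite -eq_ef (in_ends eE e1) eqxx => /esym h1.
have := in_ends fE e2; rewrite -eq_ef (in_ends eE e2) eqxx orbT => /esym h2.
(* Both pairs list the smaller end first, so equal sets of ends come from equal pairs. *)
have eq1 : e.1 = f.1.
  by move: h1 h2 e12 f12; case: (e.1) (f.1) => [a b] [c d] /= *; congr (_, _); lia.
have : nth e E (index e E) = nth e E (index f E); last by rewrite !nth_index.
congr nth; apply/eqP.
rewrite -(nth_uniq (0, 0) _ _ uniq_ends) ?size_map ?index_mem //.
by rewrite !(nth_map e) ?index_mem // !nth_index // eq1.
Qed.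

Let uniq_E : uniq E.
Proof. exact: map_uniq uniq_ends. Qed.

Let map_ends : map (@edge_ends _) es = map ends E.
Proof. by rewrite /es -map_comp. Qed.

Let uniq_map_ends : uniq (map ends E).
Proof. by rewrite (map_inj_in_uniq ends_inj). Qed.

Let edges : {set {set 'I_N.+1}} := [set:: map (@edge_ends _) es].
Let red : {set {set 'I_N.+1}} := [set:: map (@edge_ends _) (filter snd es)].

Let edges_card2 e : e \in edges -> #|e| = 2.
Proof.
rewrite inE map_ends => /mapP [x /endsP [h h1 h2 _] ->].
by rewrite cards2 -val_eqE /= !inordK // neq_ltn h.
Qed.

Let red_sub : red \subset edges.
Proof.
apply/subsetP => e; rewrite !inE => /mapP [x]; rewrite mem_filter => /andP [_ xes] ->.
exact: map_f.
Qed.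

Definition instance_of_edges : em_instance := EMInstance edges_card2 red_sub k_gt0.

Lemma instance_of_edges_encoded :
  em_encoded instance_of_edges (Posz N.+1 :: Posz k :: code E).
Proof.
exists es; split=> //=; first by rewrite map_ends.
congr (_ :: _ :: _); rewrite /code /es -map_comp; congr flatten.
apply/eq_in_map => e /endsP [_ h1 h2 h3]; rewrite /edge_code /= !inordK //.
by move: h3; case: (e.2) => [|[|?]].
Qed.

Lemma card_instance_of_edges : #|em_edges instance_of_edges| <= size E.
Proof. by rewrite /= cardsE -(size_map ends) -map_ends card_size. Qed.

Let mem_red e : e \in E -> (ends e \in red) = (e.2 == 1).
Proof.
move=> eE; rewrite inE; apply/mapP/idP.
  case=> x; rewrite mem_filter => /andP [x2 /mapP [f fE ex]] eq_ef.
  rewrite (ends_inj eE fE); first by move: x2; rewrite ex.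
  by rewrite eq_ef ex.
move=> e2; exists (inord e.1.1, inord e.1.2, true) => //.
rewrite mem_filter /= -e2; exact: map_f.
Qed.

Let card_selected (M : {set {set 'I_N.+1}}) (P : pred {set 'I_N.+1}) : M \subset edges ->
  #|[set x in M | P x]| = count (P \o ends) [seq e <- E | ends e \in M].
Proof.
move=> /subsetP sM.
have -> : [set x in M | P x] = [set:: [seq x <- map ends E | P x && (x \in M)]].
  apply/setP => x; rewrite !inE mem_filter.
  case xM: (x \in M); last by rewrite !andbF.
  by move/sM: xM; rewrite inE map_ends => ->; rewrite !andbT.
rewrite cardsE; have /card_uniqP -> := filter_uniq (fun x => P x && (x \in M)) uniq_map_ends.
by rewrite filter_map size_map size_filter -count_filter; apply: eq_count.
Qed.

Let count_incidence (s : seq edge) v : {subset s <= E} -> v < N.+1 ->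
  \sum_(e <- s) incidence v e = count (fun e => inord v \in ends e) s.
Proof.
move=> sE hv; rewrite -sum1_count [RHS]big_mkcond [LHS]big_seq [RHS]big_seq.
apply: eq_bigr => e /sE eE; rewrite in_ends //; have [h _ _ _] := endsP eE.
by rewrite /incidence !(eq_sym v); case: eqP => [e1|_]; case: eqP => [e2|_] //; move: h; rewrite e1 e2 ltnn.
Qed.

Let count_red (s : seq edge) : {subset s <= E} ->
  \sum_(e <- s) e.2 = count (fun e => ends e \in red) s.
Proof.
move=> sE; rewrite -sum1_count [RHS]big_mkcond [LHS]big_seq [RHS]big_seq.
by apply: eq_bigr => e /sE eE; rewrite mem_red //; have [_ _ _] := endsP eE; case: (e.2) => [|[|?]].
Qed.

Let setIred (M : {set {set 'I_N.+1}}) : M :&: red = [set x in M | x \in red].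
Proof. by apply/setP => x; rewrite !inE. Qed.

Lemma instance_of_edges_yes :
  em_yes instance_of_edges <-> weighted_matching N.+1 E k.
Proof.
split.
  case=> M [[sM cov] wt]; exists [seq ends e \in M | e <- E].
  have sub : {subset [seq e <- E | ends e \in M] <= E}.
    by move=> e; rewrite mem_filter => /andP [].
  rewrite -filter_mask size_map; split=> //.
    by move=> v hv; rewrite count_incidence // -(cov (inord v)) card_selected.
  by move: wt; rewrite count_red // setIred card_selected.
case=> m [sm cov wt].
have sE : {subset mask m E <= E} by move=> e /mem_mask.
pose M : {set {set 'I_N.+1}} := [set:: map ends (mask m E)].
have sM : M \subset edges.
  apply/subsetP => x; rewrite !inE map_ends => /mapP [e /sE eE ->]; exact: map_f.
(* A subsequence of a list without repetition is determined by the set of its elements. *)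
have selE : [seq e <- E | ends e \in M] = mask m E.
  have /(subseq_uniqP uniq_E) -> := mask_subseq m E.
  apply: eq_in_filter => e eE; rewrite inE /=.
  apply/mapP/idP => [[f fm eq_ef]|em]; last by exists e.
  by rewrite (ends_inj eE (sE _ fm) eq_ef).
exists M; split; first split=> //.
  move=> v; rewrite card_selected // selE -(cov v (ltn_ord v)) count_incidence //.
  by apply: eq_count => e /=; rewrite inord_val.
by rewrite setIred card_selected // selE -count_red //; apply: wt.
Qed.

End Instance.

(** * Simplicity and size of the subdivided graph *)

Definition proper_edge N (e : edge) := (e.1.1 < e.1.2 < N) && (e.2 <= 1).

(* An edge is determined by its larger end, except that the last vertex of a path
   can be the larger end of two edges, exactly one of which has an end below [n]. *)
Definition edge_key n (e : edge) := e.1.2.*2 + (e.1.1 < n).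

(** The range is recorded because consecutive ranges make distinctness pass to concatenations. *)
Definition keys_in n lo hi (s : seq edge) :=
  uniq (map (edge_key n) s) /\ forall e, e \in s -> lo <= edge_key n e < hi.

Lemma keys_in_cat n lo mid hi s1 s2 : lo <= mid <= hi ->
  keys_in n lo mid s1 -> keys_in n mid hi s2 -> keys_in n lo hi (s1 ++ s2).
Proof.
move=> /andP [le1 le2] [u1 h1] [u2 h2]; split.
  rewrite map_cat cat_uniq u1 u2 andbT; apply/hasPn => _ /mapP [e /h2 he ->].
  by apply/negP => /mapP [f /h1 hf ef]; move: he hf; rewrite ef; lia.
by move=> e; rewrite mem_cat => /orP [/h1|/h2]; lia.
Qed.

(** The correction [w == 0] serves the end of the induction: there only the closing edge from [a] to
    [u] can remain, with [v = u + 1], and its key is [2 u + 1 = 2 v - 1]. *)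
Lemma subdivide_keys n w a u v f : a < n <= u -> u < v ->
  (0 < w) || (v == u.+1) ->
  keys_in n (v.*2 - (w == 0)) (v + w.*2).*2 (subdivide (a, u, w, f) v) /\
  forall e, e \in subdivide (a, u, w, f) v -> proper_edge (v + w.*2) e.
Proof.
move=> /andP [an nu]; elim: w u v nu => [|w IH] u v nu uv /= h.
  rewrite /= addn0 (eqP h) /=.
  case: f; last by split=> //; split.
  split; first split=> // e; last move=> e.
    by rewrite inE => /eqP ->; rewrite /edge_key /= an; lia.
  by rewrite inE => /eqP ->; rewrite /proper_edge /=; lia.
have [k p] : _ /\ _ := IH v.+1 v.+2 (leqW (leq_trans nu (ltnW uv))) (leqnn _) (introT orP (or_intror (eqxx _))).
have eqv : v.+2 + w.*2 = v + w.+1.*2 by lia.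
rewrite eqv in k p.
split; last first.
  move=> e; rewrite !inE => /or3P [/eqP ->|/eqP ->|/p //]; rewrite /proper_edge /=; lia.
have nv : n <= v by lia.
apply: (@keys_in_cat n _ (v.+2.*2 - (w == 0)) _ [:: (u, v, 1); (v, v.+1, 0)] _ _ _ k); first by lia.
rewrite /keys_in /= /edge_key /= ltnNge nu ltnNge nv /= inE; split; first by lia.
by move=> e; rewrite !inE => /orP [] /eqP -> /=; rewrite ltnNge ?nu ?nv /=; lia.
Qed.

Definition proper_vedge n v (e : vedge) :=
  [&& e.1.1.1 < n, n <= e.1.1.2, e.1.1.2 < v & 0 < vweight e].

Lemma subdivide_all_keys n L v : all (proper_vedge n v) L ->
  keys_in n v.*2 (vsize v L).*2 (subdivide_all v L) /\
  forall e, e \in subdivide_all v L -> proper_edge (vsize v L) e.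
Proof.
elim: L v => [|[[[a u] w] f] L IH] v; first by [].
rewrite [all _ _]/= => /andP [/and4P /= [an nu uv w0] pL].
have [k1 p1] : _ /\ _ := @subdivide_keys n w a u v f (introT andP (conj an nu)) uv (introT orP (or_introl w0)).
have /IH [k2 p2] : all (proper_vedge n (v + w.*2)) L.
  by apply: sub_all pL => e; rewrite /proper_vedge; lia.
have eqv : vsize (v + w.*2) L = vsize v ((a, u, w, f) :: L).
  by rewrite /vsize /= doubleD addnA.
have le_v : v + w.*2 <= vsize v ((a, u, w, f) :: L) by rewrite -eqv /vsize leq_addr.
rewrite eqv in k2 p2; split.
  apply: keys_in_cat k2; first by rewrite !leq_double leq_addr.
  by move: k1; rewrite (gtn_eqF w0) subn0.
move=> e; rewrite mem_cat => /orP [/p1|/p2 //].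
by rewrite /proper_edge => /andP [/andP [-> h] ->]; rewrite (leq_trans h le_v).
Qed.

Lemma uniq_subdivide_all n L v : all (proper_vedge n v) L ->
  uniq (map fst (subdivide_all v L)).
Proof.
move=> /subdivide_all_keys [[uk _] _].
apply: (@map_uniq _ _ (fun p => p.2.*2 + (p.1 < n))).
by rewrite -map_comp.
Qed.

(** A path of weight [w >= 1] has at most [2 w + 1 <= 3 w] edges. *)
Lemma size_subdivide_all n L v : all (proper_vedge n v) L ->
  size (subdivide_all v L) <= 3 * sumn (map vweight L).
Proof.
elim: L v => [|[[[a u] w] f] L IH] v //.
rewrite [all _ _]/= => /andP [/and4P /= [_ _ _ w0] pL].
have /IH h : all (proper_vedge n (v + w.*2)) L.
  by apply: sub_all pL => e; rewrite /proper_vedge; lia.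
have size_path u' v' : size (path_edges w u' v') = w.*2.
  by elim: w {w0 pL h} u' v' => //= w IHw u' v'; rewrite IHw.
rewrite [sumn _]/= [subdivide_all _ _]/= !size_cat size_path -[vweight (a, u, w, f)]/w.
have lef : size (if f then [:: (a, path_end w u v, 0)] else [::]) <= 1 by case: (f).
apply: leq_trans (leq_add (leq_add (leqnn _) lef) h) _.
by rewrite mulnDr leq_add2r; move: w0; rewrite /vweight /=; lia.
Qed.

(** * Colours, their weights and digits in base [n] *)

Section Colours.
Variable n : nat.

Lemma colours_path prev w ds : path gtn prev (map fst (colours n prev w ds)).
Proof. by elim: ds prev w => //= d ds IH prev w; case: ltnP => [lt_d|_]; rewrite /= ?lt_d IH. Qed.

Lemma colours_uniq prev w ds : uniq (map fst (colours n prev w ds)).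
Proof.
apply: (@sorted_uniq _ gtn); first by move=> a b c; rewrite /=; lia.
  by move=> a; rewrite /= ltnn.
exact: path_sorted (colours_path prev w ds).
Qed.

Lemma mem_colours prev w ds y : path geq prev ds ->
  (y \in map fst (colours n prev w ds)) = (y \in ds) && (y < prev).
Proof.
elim: ds prev w => //= d ds IH prev w /andP [le_d pd].
have le_y : y \in ds -> y <= d.
  by move: y {IH}; apply/allP; apply: order_path_min pd => a b c; rewrite /=; lia.
have [lt_d|ge_d] := ltnP d prev.
  rewrite /= !inE IH //; case: eqP => [->|/eqP ny] //=.
  by case: (y \in ds) le_y => //= /(_ isT); lia.
have ed : d = prev by lia.
rewrite IH -?ed // inE; case: eqP => [->|_] //.
by rewrite ltnn andbF.
Qed.

Lemma colours_weights prev w ds :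
  map snd (colours n prev w ds) =
  [seq w * n ^ i | i <- iota 0 (size (colours n prev w ds))].
Proof.
elim: ds prev w => //= d ds IH prev w; case: ltnP => //= _.
rewrite IH muln1 (iotaDl 1) -map_comp; congr (_ :: _).
by apply: eq_map => i /=; rewrite add1n expnS mulnA.
Qed.

(** The first term counts further copies of the current colour [prev], which is not among the
    colours still to come. *)
Lemma weight_sumE prev wn w ds : path geq prev ds ->
  weight_sum n prev wn w ds =
  w * count_mem prev ds + \sum_(c <- colours n prev wn ds) c.2 * count_mem c.1 ds.
Proof.
elim: ds prev wn w => [|d ds IH] prev wn w; first by rewrite big_nil muln0.
rewrite [path _ _ _]/= => /andP [le_d pd].
have lt_c c : c \in colours n d (wn * n) ds -> c.1 < d.
  by move/(map_f fst); rewrite mem_colours // => /andP [].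
have lt_c' c : c \in colours n prev wn ds -> c.1 < prev.
  by move/(map_f fst) => h; have /allP/(_ _ h) := order_path_min (rev_trans ltn_trans) (colours_path prev wn ds).
rewrite /=; have [lt_d|ge_d] := ltnP d prev.
  rewrite big_cons IH //= eqxx (ltn_eqF lt_d) add0n.
  have -> : count_mem prev ds = 0.
    apply/count_memPn/negP => pin; move: lt_d.
    have /allP/(_ _ pin) := order_path_min (rev_trans leq_trans) pd.
    by rewrite /=; lia.
  rewrite muln0 add0n mulnDr muln1 -addnA; congr (_ + (_ + _)).
  by apply: eq_big_seq => c /lt_c lt; rewrite (gtn_eqF lt) add0n.
have ed : d = prev by lia.
rewrite IH -?ed // eqxx mulnDr muln1 -addnA; congr (_ + (_ + _)).
by apply: eq_big_seq => c; rewrite ed => /lt_c' lt; rewrite (gtn_eqF lt) add0n.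
Qed.

(** Horner's rule, the lowest digit first. *)
Lemma colours_sum (f : nat * nat -> nat) prev w ds :
  \sum_(c <- colours n prev w ds) c.2 * f c =
  w * foldr (fun c s => f c + n * s) 0 (colours n prev w ds).
Proof.
elim: ds prev w => [|d ds IH] prev w /=; first by rewrite big_nil muln0.
by case: ifP => _ //; rewrite big_cons IH /= mulnDr mulnA.
Qed.

Lemma colours_gt0 prev w ds c : 0 < n -> 0 < w -> c \in colours n prev w ds -> 0 < c.2.
Proof.
move=> n0 w0 /(map_f snd); rewrite colours_weights => /mapP [i _ ->].
by rewrite muln_gt0 w0 expn_gt0 n0.
Qed.

(** Each of the [p] colours contributes [n ^ i * n ^ 2 <= n ^ p.+1], since [i < p]. *)
Lemma sum_colours_leq prev ds p : 0 < n -> size (colours n prev 1 ds) = p ->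
  sumn (map snd (colours n prev 1 ds)) * n * n <= n ^ p.+1 * p.
Proof.
move=> n0 ep; rewrite colours_weights ep.
rewrite (eq_map (fun i => mul1n (n ^ i))).
have h s : all (gtn p) s -> sumn (map (expn n) s) * n * n <= n ^ p.+1 * size s.
  elim: s => // i s IH /andP [lt_i /IH h].
  rewrite -[sumn _]/(n ^ i + sumn (map (expn n) s)) -[size _]/(size s).+1.
  have le2 : i.+2 <= p.+1 by move: lt_i; rewrite /=; lia.
  rewrite !mulnDl mulnS; apply: (leq_add _ h).
  by rewrite -mulnA mulnn -expnD addn2; apply: (leq_pexp2l n0 le2).
have := h (iota 0 p); rewrite size_iota; apply.
by apply/allP => i; rewrite mem_iota.
Qed.

(** Residues modulo [n] compare the lowest digits. The value [n], which is no digit, is harmless for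
    [f]: it would leave residue 0, while [g c] is a nonzero residue. *)
Lemma digits_unique (T : eqType) (s : seq T) (f g : T -> nat) : 0 < n ->
  (forall c, c \in s -> f c <= n) -> (forall c, c \in s -> 0 < g c < n) ->
  foldr (fun c t => f c + n * t) 0 s = foldr (fun c t => g c + n * t) 0 s ->
  {in s, f =1 g}.
Proof.
move=> n0; elim: s => //= c s IH hf hg e.
have fc := hf c (mem_head _ _); have gc := hg c (mem_head _ _).
have /(congr1 (modn^~ n)) := e.
rewrite ![_ + n * _]addnC ![n * _]mulnC !modnMDl [g c %% n]modn_small; last by lia.
move=> em; have efg : f c = g c.
  case: (ltngtP (f c) n) fc em => // [lt _|-> _]; first by rewrite modn_small.
  by rewrite modnn => g0; move: gc; rewrite -g0.
move=> d; rewrite inE => /predU1P [-> //|]; apply: IH.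
- by move=> x xs; apply: hf; rewrite inE xs orbT.
- by move=> x xs; apply: hg; rewrite inE xs orbT.
by move: e; rewrite efg => /addnI/eqP; rewrite eqn_pmul2l // => /eqP.
Qed.

End Colours.

(** * Position matchings *)

(** Elements of [D] appear by value, so that [perm_eq] expresses their multiplicities; those of [A]
    and [T] appear by index. *)
Definition pm_solution n (ds ts : seq nat) (As : seq int) (s : seq (nat * nat * nat)) :=
  [/\ perm_eq [seq x.1.1 | x <- s] ds, perm_eq [seq x.1.2 | x <- s] (iota 0 n),
      perm_eq [seq x.2 | x <- s] (iota 0 n)
    & all (fun x => feas x.1.1 (nth 0%R As x.1.2) (nth 0 ts x.2)) s].

Lemma zip_iota (T : Type) (x : T) k s :
  zip (iota k (size s)) s = [seq (k + i, nth x s i) | i <- iota 0 (size s)].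
Proof.
elim: s k => //= y s IH k; rewrite addn0 IH (iotaDl 1) -map_comp.
by congr (_ :: _); apply: eq_map => i /=; rewrite addSnnS.
Qed.

Lemma perm_iotaE n s : all (gtn n) s ->
  perm_eq s (iota 0 n) <-> forall i, i < n -> count_mem i s = 1.
Proof.
move=> /allP lt_s; split=> [/permP h i lt_i|h].
  by rewrite h count_uniq_mem ?iota_uniq // mem_iota lt_i.
apply/allP => i /= _; rewrite [X in _ == X]count_uniq_mem ?iota_uniq // mem_iota.
case: ltnP => [/h -> //|le_i]; apply/eqP/count_memPn/negP => /lt_s /=; lia.
Qed.

(** * Matchings of virtual edges against position matchings *)

Section Base.
Variables (n : nat) (Ds ts : seq nat) (As : seq int).
Hypotheses (n_gt0 : 0 < n) (sorted_Ds : sorted geq Ds).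
Hypotheses (size_Ds : size Ds = n) (size_ts : size ts = n) (size_As : size As = n).

Let d0 := (head 0 Ds).+1.
Let cs := colours n d0 1 Ds.

Let path_Ds : path geq d0 Ds.
Proof. by rewrite /d0; case: (Ds) sorted_Ds => //= d s ->; rewrite leqnSn. Qed.

Let uniq_cs1 : uniq (map fst cs). Proof. exact: colours_uniq. Qed.

Let uniq_cs : uniq cs. Proof. exact: map_uniq uniq_cs1. Qed.

Let mem_cs y : (y \in map fst cs) = (y \in Ds).
Proof.
rewrite mem_colours //; case yD: (y \in Ds) => //=.
have /allP/(_ _ yD) : all (geq (head 0 Ds)) Ds.
  move: sorted_Ds; rewrite /sorted; case: (Ds) => //= d s.
  by move/(order_path_min (rev_trans leq_trans)); rewrite leqnn.
by rewrite /d0 ltnS.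
Qed.

Let fst_inj : {in cs &, injective (@fst nat nat)}.
Proof.
move=> c c' cin c'in e.
have : nth c cs (index c cs) = nth c cs (index c' cs); last by rewrite !nth_index.
congr nth; apply/eqP.
rewrite -(nth_uniq 0 _ _ uniq_cs1) ?size_map ?index_mem //.
by rewrite !(nth_map c) ?index_mem // !nth_index // e.
Qed.

(** A colour with its weight, an index in [As] and an index in [ts]. *)
Let triple := (nat * nat * nat * nat)%type.

Let triples : seq triple :=
  [seq (q, l) | q <- [seq (c, j) | c <- cs, j <- iota 0 n], l <- iota 0 n].

(** Vertices below [n] stand for the elements of [A], those from [n] up to [2 n - 1] for the
    elements of [T]. *)
Let vedge_of (q : triple) : vedge :=
  (q.1.2, n + q.2, q.1.1.2, feas q.1.1.1 (nth 0%R As q.1.2) (nth 0 ts q.2)).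

Let all_vedgesE : all_vedges n ts As cs = map vedge_of triples.
Proof.
rewrite /triples map_allpairs; elim: (cs) => //= c s IH.
rewrite flatten_cat map_cat -IH /all_vedges /= map_flatten; congr (_ ++ _).
rewrite /colour_vedges (zip_iota 0%R) size_As -!map_comp; congr flatten.
apply: eq_map => j /=; rewrite /row_vedges (zip_iota 0) size_ts -!map_comp.
exact: eq_map.
Qed.

Let Q := [seq q <- triples | (vedge_of q).2].

Let virtualE : virtual_edges (all_vedges n ts As cs) = map (fun q => (vedge_of q).1) Q.
Proof. by rewrite all_vedgesE /virtual_edges filter_map -map_comp. Qed.

Let mem_triples q : (q \in triples) = [&& q.1.1 \in cs, q.1.2 < n & q.2 < n].
Proof.
case: q => [[c j] l]; apply/allpairsPdep/and3P => /=.
  case=> q [l' [/allpairsPdep [c' [j' [h1 h2 ->]]] h3 [-> -> ->]]].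
  by move: h2 h3; rewrite !mem_iota.
case=> h1 h2 h3; exists (c, j), l; rewrite mem_iota h3; split=> //.
by apply/allpairsPdep; exists c, j; rewrite mem_iota.
Qed.

Lemma proper_all_vedges : all (proper_vedge n n.*2) (all_vedges n ts As cs).
Proof.
rewrite all_vedgesE all_map; apply/allP => q /=; rewrite mem_triples.
move=> /and3P [h1 h2 h3]; rewrite /proper_vedge /vweight /= h2 leq_addr.
by rewrite -addnn ltn_add2l h3 (colours_gt0 _ _ h1).
Qed.

Lemma sum_vweight : sumn (map vweight (all_vedges n ts As cs)) = sumn (map snd cs) * n * n.
Proof.
rewrite all_vedgesE -map_comp /triples map_allpairs; elim: (cs) => //= c s IH.
rewrite flatten_cat map_cat sumn_cat IH !mulnDl map_flatten -map_comp; congr (_ + _).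
have h k js : sumn (flatten [seq [seq c.2 | l <- iota k n] | j : nat <- js]) = c.2 * n * size js.
  elim: js => [|j js IHj] /=; first by rewrite muln0.
  rewrite sumn_cat IHj mulnS; congr (_ + _).
  rewrite -[in RHS](size_iota k n).
  by elim: (iota k n) => [|l ls IHl] /=; rewrite ?muln0 // IHl mulnS.
have := h 0 (iota 0 n); rewrite size_iota => <-; congr (sumn (flatten _)).
by apply: eq_map => j /=; rewrite -map_comp; apply: eq_map.
Qed.

Let uniq_Q : uniq Q.
Proof.
apply: filter_uniq; apply: allpairs_uniq; rewrite ?iota_uniq //.
  by apply: allpairs_uniq; rewrite ?iota_uniq // => -[? ?] [? ?] _ _ [-> ->].
by move=> -[? ?] [? ?] _ _ [-> ->].
Qed.

Let mem_Q q : q \in Q -> [/\ q.1.1 \in cs, q.1.2 < n, q.2 < n & (vedge_of q).2].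
Proof. by rewrite mem_filter mem_triples => /andP [h1 /and3P [h2 h3 h4]]. Qed.

Let cover_perm s : {subset s <= Q} ->
  (forall v, v < n.*2 -> \sum_(e <- [seq (vedge_of q).1 | q <- s]) incidence v e = 1) <->
  perm_eq [seq q.1.2 | q <- s] (iota 0 n) /\ perm_eq [seq q.2 | q <- s] (iota 0 n).
Proof.
move=> sQ.
have allj : all (gtn n) [seq q.1.2 | q <- s].
  by apply/allP => _ /mapP [q /sQ/mem_Q [_ h _ _] ->].
have alll : all (gtn n) [seq q.2 | q <- s].
  by apply/allP => _ /mapP [q /sQ/mem_Q [_ _ h _] ->].
have cj v : v < n -> \sum_(e <- [seq (vedge_of q).1 | q <- s]) incidence v e =
    count_mem v [seq q.1.2 | q <- s].
  move=> lt_v; rewrite -sum1_count !big_map [RHS]big_mkcond; apply: eq_bigr => q _.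
  rewrite /incidence /= (_ : (n + q.2 == v) = false) ?addn0; last by lia.
  by case: eqP.
have cl v : v < n -> \sum_(e <- [seq (vedge_of q).1 | q <- s]) incidence (n + v) e =
    count_mem v [seq q.2 | q <- s].
  move=> lt_v; rewrite -sum1_count !big_map [RHS]big_mkcond [LHS]big_seq [RHS]big_seq.
  apply: eq_bigr => q /sQ/mem_Q [_ h _ _].
  rewrite /incidence /= (_ : (q.1.2 == n + v) = false) ?add0n; last by lia.
  by rewrite eqn_add2l; case: eqP.
split=> [h|[/(perm_iotaE allj) h1 /(perm_iotaE alll) h2] v lt_v].
  split; first by apply/(perm_iotaE allj) => v hv; rewrite -cj // h //; lia.
  by apply/(perm_iotaE alll) => v hv; rewrite -cl // h //; lia.
have [lt_vn|le_v] := ltnP v n; first by rewrite cj // h1.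
by rewrite -(subnKC le_v) cl ?h2 //; lia.
Qed.

Let sum_weight s : {subset s <= Q} ->
  \sum_(e <- [seq (vedge_of q).1 | q <- s]) e.2 =
  \sum_(c <- cs) c.2 * count_mem c.1 [seq q.1.1.1 | q <- s].
Proof.
move=> sQ; rewrite big_map /=.
rewrite (eq_bigr (fun c : nat * nat => \sum_(q <- s) c.2 * (q.1.1.1 == c.1))); last first.
  move=> c _; rewrite -big_distrr /=; congr (_ * _).
  by rewrite -sum1_count big_map [LHS]big_mkcond; apply: eq_bigr => q _ /=; case: eqP.
rewrite [RHS]exchange_big /=; apply: eq_big_seq => q /sQ/mem_Q [h _ _ _].
rewrite (bigD1_seq _ h uniq_cs) /= eqxx muln1 big_seq_cond big1 ?addn0 // => c /andP [cin ne].
case: eqP => [e|_]; last by rewrite muln0.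
by rewrite (fst_inj h cin e) eqxx in ne.
Qed.

Let weightE : weight_sum n d0 1 0 Ds = \sum_(c <- cs) c.2 * count_mem c.1 Ds.
Proof. by rewrite weight_sumE. Qed.

Let count_unique (xs : seq nat) : size xs = n ->
  \sum_(c <- cs) c.2 * count_mem c.1 xs = \sum_(c <- cs) c.2 * count_mem c.1 Ds ->
  {in cs, forall c, count_mem c.1 xs = count_mem c.1 Ds}.
Proof.
move=> sx; rewrite (@colours_sum n (fun c => count_mem c.1 xs)) (@colours_sum n (fun c => count_mem c.1 Ds)) !mul1n -/cs => e.
have cs_gt0 c : c \in cs -> 0 < count_mem c.1 Ds.
  by move=> cin; rewrite -has_count has_pred1 -mem_cs map_f.
(* A single colour has multiplicity [n], which is no digit, but then the equation of the sums is
   already the claim. *)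
have [le1|lt1] := leqP (size cs) 1.
  move: e le1; case: (cs) => [|c [|? ?]] //=.
  by rewrite !muln0 !addn0 => e _ c'; rewrite inE => /eqP ->.
apply: (digits_unique n_gt0 _ _ e) => c cin; first by rewrite -sx count_size.
rewrite cs_gt0 //=.
(* Another colour occurs in [Ds] too, so [c] occurs fewer than [n] times. *)
have [c' c'in ne] : exists2 c', c' \in cs & c' != c.
  move: lt1 uniq_cs; case: (cs) => [|x [|y s]] //= _; rewrite inE negb_or.
  move=> /andP [/andP [nxy _] _].
  have [->|nxc] := eqVneq c x; last by exists x; rewrite ?mem_head // eq_sym.
  by exists y; rewrite ?inE ?eqxx ?orbT // eq_sym.
rewrite -size_Ds -(count_predC (pred1 c.1)) -[X in X < _]addn0 ltn_add2l -has_count.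
apply/hasP; exists c'.1; first by rewrite -mem_cs map_f.
by apply: contra ne => /eqP /(fst_inj c'in cin) ->.
Qed.

Lemma base_matching :
  weighted_matching n.*2 (virtual_edges (all_vedges n ts As cs))
    (weight_sum n d0 1 0 Ds) <->
  exists s, pm_solution n Ds ts As s.
Proof.
rewrite virtualE weightE; split.
  case=> m [sm cov wt]; pose s := mask m Q.
  have sQ : {subset s <= Q} by move=> q /mem_mask.
  rewrite -map_mask -/s in cov wt.
  have [pj pl] := (cover_perm sQ).1 cov.
  exists [seq (q.1.1.1, q.1.2, q.2) | q <- s]; split; rewrite -?map_comp //.
    have size_s : size [seq q.1.1.1 | q <- s] = n.
      by rewrite size_map -(size_map (fun q : triple => q.1.2)) (perm_size pj) size_iota.
    rewrite sum_weight // in wt.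
    have eq_c := count_unique size_s wt.
    apply/allP => y _ /=; apply/eqP.
    have [/mapP [c cin ->]|ny] := boolP (y \in map fst cs); first exact: eq_c.
    have nD : y \notin Ds by rewrite -mem_cs.
    rewrite (count_memPn nD); apply/count_memPn.
    by apply: contra ny => /mapP [q /sQ/mem_Q [h _ _ _] ->]; apply: (map_f fst h).
  by apply/allP => _ /mapP [q /sQ/mem_Q [_ _ _ h] ->].
case=> s [pd pj pl fe].
(* A solution names only the value of a colour; its weight is looked up to identify the virtual
   edge. *)
pose wt y := nth 0 (map snd cs) (index y (map fst cs)).
have wtP y : y \in Ds -> (y, wt y) \in cs.
  rewrite -mem_cs => yin; have h : index y (map fst cs) < size cs.
    by rewrite -(size_map fst) index_mem.
  rewrite /wt (nth_map (0, 0)) //.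
  have -> : (y, (nth (0, 0) cs (index y (map fst cs))).2) = nth (0, 0) cs (index y (map fst cs)).
    by rewrite -{1}(nth_index 0 yin) (nth_map (0, 0)) // -surjective_pairing.
  exact: mem_nth.
pose lift (x : nat * nat * nat) : triple := (x.1.1, wt x.1.1, x.1.2, x.2).
pose s' := map lift s.
have s'Q : {subset s' <= Q}.
  move=> _ /mapP [x xs ->]; rewrite mem_filter mem_triples /=.
  rewrite (allP fe) //= wtP; last by rewrite -(perm_mem pd) (map_f (fun x => x.1.1)).
  have : x.1.2 \in iota 0 n by rewrite -(perm_mem pj) (map_f (fun x => x.1.2)).
  have : x.2 \in iota 0 n by rewrite -(perm_mem pl) (map_f snd).
  by rewrite !mem_iota /= => h1 h2; rewrite h1 h2.
have us' : uniq s'.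
  apply: (@map_uniq _ _ (fun q : triple => q.1.2)); rewrite -map_comp.
  by rewrite (perm_uniq pj) iota_uniq.
(* A mask selects in the order of [Q], so the selected edges agree with [s'] only up to a
   permutation. *)
exists [seq q \in s' | q <- Q]; rewrite -map_mask -filter_mask.
have perm_s' : perm_eq [seq q <- Q | q \in s'] s'.
  apply: uniq_perm => //; first exact: filter_uniq.
  by move=> q; rewrite mem_filter; case qs: (q \in s') => //=; apply: s'Q.
split; first by rewrite !size_map.
  move=> v lt_v; rewrite (perm_big _ (perm_map _ perm_s')) /=; move: v lt_v.
  by apply/(cover_perm s'Q); rewrite -!map_comp.
rewrite (perm_big _ (perm_map _ perm_s')) /= sum_weight //.
apply: eq_bigr => c _; congr (_ * _); rewrite -map_comp.
by have /permP -> := pd.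
Qed.

End Base.

(** * Sorting and discretizing in non-increasing order *)

Lemma perm_ins z s : perm_eq (ins z s) (z :: s).
Proof.
elim: s z => //= d s IH z; apply: (@perm_trans _ (maxn z d :: minn z d :: s)).
  by rewrite perm_cons.
by case: (leqP z d) => _ //; apply: (permEl (perm_catCA [:: d] [:: z] s)).
Qed.

Lemma path_ins m z s : z <= m -> path geq m s -> path geq m (ins z s).
Proof.
elim: s m z => [|d s IH] m z zm /=; first by rewrite zm.
case/andP=> dm pd; rewrite geq_max zm dm /=; apply: IH; first by lia.
by case: s pd => //= d' s /andP [h ->]; rewrite andbT; lia.
Qed.

Lemma sort_descP ds : sorted geq (sort_desc ds) /\ perm_eq (sort_desc ds) ds.
Proof.
suff H s : sorted geq s -> sorted geq (foldl (fun s z => ins z s) s ds) /\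
    perm_eq (foldl (fun s z => ins z s) s ds) (s ++ ds) by exact: H.
elim: ds s => [|d ds IH] s hs /=; first by rewrite cats0.
have [|h1 h2] := IH (ins d s).
  have le_m : path geq (maxn d (head 0 s)) s.
    by case: s hs => //= x s ->; rewrite leq_maxr.
  exact: path_sorted (path_ins (leq_maxl _ _) le_m).
split=> //; apply: perm_trans h2 _.
apply: (@perm_trans _ ((d :: s) ++ ds)); first by rewrite perm_cat2r perm_ins.
exact: (permEl (perm_catCA [:: d] s ds)).
Qed.

(** Appending an element to the argument of [disc] appends one value, computed from the last one;
    this matches how [discretize] extends its result at the front, whence the induction from the
    right. *)
Lemma discretize_rev (s : seq nat) :
  discretize (rev s) = rev (disc (Posz (head 0 s).+1) s).
Proof.
have disc_rcons a t d : disc a (rcons t d) =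
    rcons (disc a t) (Num.min (last a (disc a t) - 1)%R (Posz d)).
  by elim: t a => //= x t IH a; rewrite IH.
elim/last_ind: s => // s d IH; rewrite rev_rcons disc_rcons rev_rcons.
case: s IH => [|d0 s] IH.
  by rewrite /= (_ : (Posz d.+1 - 1)%R = Posz d) ?minxx //; lia.
have -> : head 0 (rcons (d0 :: s) d) = head 0 (d0 :: s) by [].
rewrite -IH; case er: (rev (d0 :: s)) => [|x t].
  by move: (congr1 size er); rewrite size_rev.
rewrite -[LHS]/(Num.min (head 0%R (discretize (x :: t)) - 1)%R (Posz d) :: discretize (x :: t)).
rewrite -er IH; congr (Num.min (_ - 1)%R _ :: _).
have : disc (Posz (head 0 (d0 :: s)).+1) (d0 :: s) != [::] by [].
by case/lastP: (disc _ _) => // l y _; rewrite rev_rcons last_rcons.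
Qed.

Lemma size_disc a s : size (disc a s) = size s.
Proof. by elim: s a => //= d s IH a; rewrite IH. Qed.

Lemma card_fiber_perm (X : finType) n (M : {set X}) (F : X -> 'I_n) :
  (forall i, #|[set x in M | F x == i]| = 1) <->
  perm_eq [seq F x | x <- enum M] (enum 'I_n).
Proof.
have cE i : #|[set x in M | F x == i]| = count_mem i [seq F x | x <- enum M].
  rewrite count_map -size_filter.
  have /card_uniqP <- := filter_uniq (preim F (pred1 i)) (enum_uniq M).
  by apply: eq_card => x; rewrite inE mem_filter mem_enum andbC.
have c1 i : count_mem i (enum 'I_n) = 1 by rewrite count_uniq_mem ?enum_uniq // mem_enum.
split=> [h|/permP h i]; last by rewrite cE h c1.
by apply/allP => i _ /=; rewrite -cE h c1.
Qed.

(** The list of solutions runs through the discretized sequence backwards, hence [rev_ord] on its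
    indices. *)
Lemma pm_yes_solution n (D T : n.-tuple nat) ds : 0 < n -> perm_eq ds D ->
  pm_yes D T <->
  exists s, pm_solution n ds T (rev (discretized D)) s.
Proof.
move=> n0 pD.
have nthA (j : 'I_n) : tnth (discretized D) j = nth 0%R (rev (discretized D)) (rev_ord j).
  rewrite (tnth_nth 0%R) nth_rev size_tuple; last exact: ltn_ord.
  by congr nth; have := ltn_ord j; rewrite /=; lia.
have rev_enum : perm_eq (map (@rev_ord n) (enum 'I_n)) (enum 'I_n).
  apply: uniq_perm; rewrite ?enum_uniq ?(map_inj_uniq rev_ord_inj) ?enum_uniq // => i.
  by rewrite mem_enum -[i]rev_ordK map_f ?mem_enum.
split.
  case=> M [/card_fiber_perm p1 /card_fiber_perm p2 /card_fiber_perm p3 hM].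
  exists [seq (tnth D x.1.1, nat_of_ord (rev_ord x.1.2), nat_of_ord x.2) | x <- enum M].
  split; rewrite -?map_comp.
  - have := perm_map (tnth D) p1; rewrite map_tnth_enum -map_comp => h.
    by apply: perm_trans h _; rewrite perm_sym.
  - have := perm_map (fun i : 'I_n => rev_ord i : nat) p2; rewrite -map_comp => h.
    apply: perm_trans h _; have := perm_map (@nat_of_ord n) rev_enum.
    by rewrite -map_comp val_enum_ord.
  - by have := perm_map (@nat_of_ord n) p3; rewrite -map_comp val_enum_ord.
  apply/allP => y /mapP [x xM ->].
  have [|h1 h2] := hM x; first by rewrite -mem_enum.
  by rewrite /feas /= -nthA -(tnth_nth 0 T) h1 h2.
case=> s [pd pj pl /allP fe].
(* A solution names values of [D]; [Is] picks for each triplet its own position holding that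
   value. *)
have /(perm_iotaP 0) [Is pI eI] := perm_trans pd pD.
rewrite size_tuple in pI.
have size_s : size s = n by rewrite -(size_map snd) (perm_size pl) size_iota.
have size_I : size Is = n by rewrite (perm_size pI) size_iota.
(* The size becomes a successor so that [inord] can turn indices into ordinals. *)
case: n n0 D T pD nthA rev_enum pd pj pl fe pI eI size_s size_I => // n _ D T pD nthA rev_enum pd pj pl fe pI eI size_s size_I.
have inord_iota : [seq inord i | i <- iota 0 n.+1] = enum 'I_n.+1.
  rewrite -val_enum_ord -map_comp -[RHS]map_id; apply: eq_map => i; exact: inord_val.
pose conv (p : nat * (nat * nat * nat)) : 'I_n.+1 * 'I_n.+1 * 'I_n.+1 :=
  (inord p.1, rev_ord (inord p.2.1.2), inord p.2.2).
pose z := zip Is s; pose xs := map conv z.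
have z1 : map fst z = Is by apply: unzip1_zip; rewrite size_s size_I.
have z2 : map snd z = s by apply: unzip2_zip; rewrite size_s size_I.
have q1 : perm_eq [seq x.1.1 | x <- xs] (enum 'I_n.+1).
  by rewrite -inord_iota -map_comp (map_comp inord fst) z1 perm_map.
have q2 : perm_eq [seq x.1.2 | x <- xs] (enum 'I_n.+1).
  have -> : [seq x.1.2 | x <- xs] = map (@rev_ord _) (map inord [seq x.1.2 | x <- map snd z]).
    by rewrite /xs -!map_comp.
  apply: perm_trans rev_enum; apply: perm_map; rewrite -inord_iota z2.
  exact: perm_map.
have q3 : perm_eq [seq x.2 | x <- xs] (enum 'I_n.+1).
  have -> : [seq x.2 | x <- xs] = map inord (map snd (map snd z)) by rewrite /xs -!map_comp.
  by rewrite -inord_iota z2 perm_map.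
have uxs : uniq xs.
  by apply: (@map_uniq _ _ (fun x => x.1.1)); rewrite (perm_uniq q1) enum_uniq.
pose M := [set:: xs].
have pM : perm_eq (enum M) xs.
  by apply: uniq_perm; rewrite ?enum_uniq // => x; rewrite mem_enum inE.
exists M; split; try by apply/card_fiber_perm; apply: perm_trans (perm_map _ pM) _.
move=> x; rewrite inE => /mapP [p pz ->] /=.
have p2s : p.2 \in s by rewrite -z2 map_f.
have p1I : p.1 \in iota 0 n.+1 by rewrite -(perm_mem pI) -z1 map_f.
have p1E : nth 0 D p.1 = p.2.1.1.
  have lt_k : index p z < size z by rewrite index_mem.
  have := congr1 (fun l => nth 0 l (index p z)) eI.
  rewrite -z1 -z2 -!map_comp !(nth_map p) // nth_index //= => ->.
have p12 : p.2.1.2 \in iota 0 n.+1.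
  by rewrite -(perm_mem pj) (map_f (fun x : nat * nat * nat => x.1.2)).
have p22 : p.2.2 \in iota 0 n.+1 by rewrite -(perm_mem pl) (map_f snd).
move: p1I p12 p22; rewrite !mem_iota /= => h1 h2 h3.
rewrite nthA rev_ordK !(tnth_nth 0) /= !inordK // p1E.
by have := fe _ p2s; rewrite /feas => /andP.
Qed.

(** Here [90 = 20 + 34 + 36]: both [n] and [n ^ 2] are at most [c.2 * n ^ 2]. *)
Lemma print_cost_leq n (cs : seq (nat * nat)) : 0 < n ->
  (forall c, c \in cs -> 0 < c.2) ->
  sumn [seq n * (n * (20 * c.2 + 34) + 36) | c <- cs] <= 90 * (sumn (map snd cs) * n * n).
Proof.
move=> n0; elim: cs => //= c cs IH h.
have c0 := h c (mem_head _ _).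
have /IH h' : forall x, x \in cs -> 0 < x.2 by move=> x xc; apply: h; rewrite inE xc orbT.
have h1 : n * (n * (20 * c.2 + 34) + 36) <= 90 * (c.2 * n * n).
  have n2 : n * n <= c.2 * n * n by rewrite -mulnA leq_pmull.
  have n1 : n <= n * n by rewrite leq_pmull.
  nia.
by apply: leq_trans (leq_add h1 h') _; rewrite -mulnDr -!mulnDl.
Qed.

Theorem theorem8 :
  exists (P : program) (C : nat),
    forall (n p : nat) (D T : n.-tuple nat),
      0 < n ->
      pm_instance D T ->
      size (undup D) = p ->
      exists (I : em_instance) (y : seq int),
        [/\ computes_within P (pm_encoding D T) y (C * (n ^ p.+1 * p)),
            em_encoded I y,
            em_nv I <= C * (n ^ p.+1 * p),
            #|em_edges I| <= C * (n ^ p.+1 * p)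
          & pm_yes D T <-> em_yes I].
Proof.
(* The time needs the factor [21 + 200 + 200 + 90 = 511]; the vertices need 4 and the edges 3. *)
exists (compile 0 prog), 600 => n p D T n0 _ ep.
have [sD pD] := sort_descP D.
have size_Ds : size (sort_desc D) = n by rewrite (perm_size pD) size_tuple.
pose Ds := sort_desc D; pose d0 := (head 0 Ds).+1; pose cs := colours n d0 1 Ds.
pose As := disc (Posz d0) Ds; pose L := all_vedges n T As cs.
have size_As : size As = n by rewrite size_disc.
pose S := sumn (map snd cs); pose K := weight_sum n d0 1 0 Ds.
have sT := size_tuple T.
have pL : all (proper_vedge n n.*2) L by apply: proper_all_vedges.
have sumL : sumn (map vweight L) = S * n * n by apply: sum_vweight.
have pathD : path geq d0 Ds.
  by move: (sD); rewrite -/Ds /d0; case: (Ds) => //= d s ->; rewrite leqnSn.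
have p_cs : size cs = p.
  rewrite -ep -(perm_size (perm_undup (perm_mem pD))) -(size_map fst).
  apply/perm_size/uniq_perm; rewrite ?undup_uniq ?colours_uniq // => y.
  rewrite mem_colours // mem_undup; case yD: (y \in Ds) => //=.
  have /allP/(_ _ yD) : all (geq (head 0 Ds)) Ds.
    move: (sD); rewrite -/Ds /sorted; case: (Ds) => //= d s.
    by move/(order_path_min (rev_trans leq_trans)); rewrite leqnn.
  by rewrite /d0 ltnS.
have p0 : 0 < p.
  rewrite -ep lt0n size_eq0; apply/eqP => /undup_nil e.
  by have := size_tuple D; rewrite e => e0; rewrite -e0 in n0.
have leS : S * n * n <= n ^ p.+1 * p by apply: sum_colours_leq.
have len2 : n * n <= n ^ p.+1 * p.
  apply: leq_trans (leq_pmulr _ p0); rewrite mulnn; exact: leq_pexp2l.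
have len : n <= n * n by rewrite leq_pmull.
have K0 : 0 < K.
  have : size Ds = n := size_Ds.
  by rewrite /K /d0; case: (Ds) => [|d s] /= e; [rewrite -e in n0|rewrite ltnSn].
set N := vsize n.*2 L.
have eN : N = (S * n * n + n).*2 by rewrite /N /vsize sumL -doubleD addnC.
have N0 : 0 < N by rewrite eN; lia.
set E := subdivide_all n.*2 L.
have [_ pE] := subdivide_all_keys pL.
have {}pE : all (fun e => (e.1.1 < e.1.2 < N.-1.+1) && (e.2 <= 1)) E.
  by rewrite prednK //; apply/allP => e /pE.
have uE : uniq (map fst E) := uniq_subdivide_all pL.
have sE : size E <= 3 * (S * n * n) by rewrite -sumL; apply: size_subdivide_all pL.
exists (instance_of_edges pE K0), (Posz N :: Posz K :: code E); split.
- rewrite eN; apply: computes_within_wp; apply: wp_bound (prog_ok n0 (size_tuple D) sT) _.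
  rewrite -/Ds -/d0 -/cs.
  have cs_gt0 c : c \in cs -> 0 < c.2 by apply: colours_gt0.
  have := print_cost_leq n0 cs_gt0; rewrite -/S; lia.
- rewrite -[in Posz N](prednK N0); exact: instance_of_edges_encoded.
- by rewrite /= prednK // eN; lia.
- by apply: leq_trans (card_instance_of_edges _ _) _; lia.
have eA : rev (discretized D) = As.
  rewrite /As /discretized /=.
  have -> : sort leq D = rev Ds.
    apply: (sorted_eq leq_trans anti_leq); first exact: sort_sorted leq_total _.
      by rewrite rev_sorted.
    by rewrite perm_sort perm_sym perm_rev.
  by rewrite discretize_rev revK.
have ps := @pm_yes_solution n D T Ds n0 pD; rewrite eA in ps.
apply: (iff_trans ps).
apply: (iff_trans (iff_sym (base_matching n0 sD size_Ds sT size_As))).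
rewrite -/d0.
have bL : edges_below n.*2 (map fst L).
  rewrite /edges_below all_map; apply: sub_all pL => e /and4P [h1 h2 h3 _] /=.
  by rewrite h3; lia.
have := @subdivide_all_matching L n.*2 [::] K isT bL; rewrite !cat0s => h.
apply: (iff_trans h); rewrite -/N -/E; apply: iff_sym.
rewrite -[X in weighted_matching X _ _](prednK N0); exact: instance_of_edges_yes.
Qed.
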